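(* Let $\mathscr{A}=c_0\text{-}\bigoplus_{i\in I}\mathbb{K}(\mathscr{H}_i)$ be a $C^*$-algebra of compact operators, let $\mathscr{X},\mathscr{Y}$ be Hilbert $\mathscr{A}$-modules, and let $t:\mathrm{Dom}(t)\subseteq\mathscr{X}\to\mathscr{Y}$ be a densely defined closed $\mathscr{A}$-linear operator. Then: (a) $t^*(tt^* )^{\dagger}\subseteq t^{\dagger}$. (b) $t^{\dagger}\subseteq(t^*t)^{\dagger}t^*$ if and only if $\mathrm{Ran}(t)\subseteq\mathrm{Dom}(t^* )$. (c) If $t$ has closed range, then $t^*(tt^* )^{\dagger}=t^{\dagger}$; and if moreover $\mathrm{Ran}(t)\subseteq\mathrm{Dom}(t^* )$, then $t^{\dagger}=(t^*t)^{\dagger}t^*$. (d) If $\mathscr{X}=\mathscr{Y}$ and $S$ is a bounded adjointable operator on $\mathscr{X}$ which commutes with $t$ and $t^*$ (i.e. $St\subseteq tS$ and $St^*\subseteq t^*S$), then $St^{\dagger}\subseteq t^{\dagger}S$. (e) If $\mathscr{X}=\mathscr{Y}$, then $t$ is self-adjoint (i.e. $t=t^*$) if and only if $t=\overline{t^{\dagger}t}\,t^*$.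
   Context: Here $\mathbb{K}(\mathscr{H}_i)$ is the $C^*$-algebra of all compact operators on a Hilbert space $\mathscr{H}_i$, and $\mathscr{A}$ is a $c_0$-direct sum of such algebras over an arbitrary index set $I$. Hilbert modules are right modules with $\mathscr{A}$-valued inner product linear in the second variable. Operators are $\mathscr{A}$-linear maps defined on a submodule, possibly unbounded. For operators $t,s$, $t\subseteq s$ means $\mathrm{Dom}(t)\subseteq\mathrm{Dom}(s)$ and $s(x)=t(x)$ for all $x\in\mathrm{Dom}(t)$; $t=s$ includes equality of domains. Composition: $\mathrm{Dom}(ts)=\{x\in\mathrm{Dom}(s): s(x)\in\mathrm{Dom}(t)\}$. A bar over an operator denotes its closure (the operator whose graph is the closure of the graph). A densely defined operator $t$ is adjointable if the operator $t^*$ with domain $\mathrm{Dom}(t^* )=\{y\in\mathscr{Y}:\exists z\in\mathscr{X},\ \langle t(x),y\rangle=\langle x,z\rangle\ \forall x\in\mathrm{Dom}(t)\}$, $t^*(y)=z$, is densely defined. An operator $t$ is regular if it is densely defined, closed, adjointable, and $\mathrm{Ran}(1+t^*t)$ is dense in $\mathscr{X}$. A Moore-Penrose inverse of a regular operator $t$ from $\mathscr{X}$ to $\mathscr{Y}$ is a regular operator $s$ from $\mathscr{Y}$ to $\mathscr{X}$ with $tst=t$, $sts=s$, $(ts)^*=\overline{ts}$, $(st)^*=\overline{st}$. It is known that, over a $C^*$-algebra of compact operators, every densely defined closed operator $t$ between Hilbert $\mathscr{A}$-modules is automatically regular and has a unique Moore-Penrose inverse $t^{\dagger}$, given by $\mathrm{Dom}(t^{\dagger})=\mathrm{Ran}(t)\oplus\mathrm{Ker}(t^*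 )$ and $t^{\dagger}(t(x_1+x_2)+x_3)=x_1$ for $x_1\in\mathrm{Dom}(t)\cap\overline{\mathrm{Ran}(t^* )}$, $x_2\in\mathrm{Ker}(t)$, $x_3\in\mathrm{Ker}(t^* )$. The same formula applied to the regular operators $t^*t$ and $tt^*$ gives $(t^*t)^{\dagger}$ and $(tt^* )^{\dagger}$. *)

(* Defs.v *)
From HB Require Import structures.
From mathcomp Require Import all_boot all_order all_algebra.
From mathcomp Require Import all_classical all_reals all_analysis.
From mathcomp Require Import sesquilinear complex.

Set Implicit Arguments.
Unset Strict Implicit.
Unset Printing Implicit Defensive.

Import Order.TTheory GRing.Theory Num.Theory.
Import numFieldNormedType.Exports.

Local Open Scope classical_set_scope.
Local Open Scope ring_scope.
Local Open Scope complex_scope.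

(* Complex Hilbert spaces. The library's dot products are linear in the first
   variable and conjugate-linear in the second one. *)
Record hilbertSpace (R : realType) := HilbertSpace {
  hs_sort :> completeNormedModType R[i];
  hs_dot : {dot hs_sort for @Num.conj R[i]};
  hs_normE : forall u : hs_sort, `|u| ^+ 2 = hs_dot u u }.

Section BoundedOperators.
Context {R : realType}.
Implicit Types H : hilbertSpace R.

(* Norms in a normed module over R[i] are R[i]-valued, whence Re. *)
Definition opnorm H (f : H -> H) : R :=
  sup [set complex.Re `|f u| | u in [set u : H | `|u| <= 1]].

Definition compact_operator H (f : H -> H) : Prop :=
  [/\ linear f, continuous f & precompact (f @` [set u : H | `|u| <= 1])].

Lemma Re_norm (V : normedZmodType R[i]) (u : V) :
  (complex.Re `|u|)%:C = `|u|.
Proof. exact: RRe_real (ger0_real (normr_ge0 u)). Qed.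

Lemma Re_norm_le (V W : normedModType R[i]) (u : V) (v : W) :
  (complex.Re `|u| <= complex.Re `|v|) = (`|u| <= `|v|).
Proof. by rewrite -lecR !Re_norm. Qed.

Lemma Re_norm_leD (V : normedModType R[i]) (u v : V) :
  complex.Re `|u + v| <= complex.Re `|u| + complex.Re `|v|.
Proof. by rewrite -lecR rmorphD/= !Re_norm ler_normD. Qed.

Lemma Re_normZ (V : normedModType R[i]) (c : R[i]) (v : V) :
  complex.Re `|c *: v| = complex.Re `|c| * complex.Re `|v|.
Proof.
by apply: (@complexI R); rewrite rmorphM/= !Re_norm normrZ.
Qed.

Lemma opnorm_le H (f : H -> H) (M : R) :
  (forall u : H, `|u| <= 1 -> complex.Re `|f u| <= M) -> opnorm f <= M.
Proof.
move=> fM; apply: ge_sup; last by move=> _ [u /= u1 <-]; exact: fM.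
by exists (complex.Re `|f 0|); exists 0; rewrite //= normr0 ler01.
Qed.

Lemma opnorm_ub H (f : H -> H) (u : H) : linear f -> continuous f ->
  complex.Re `|f u| <= opnorm f * complex.Re `|u|.
Proof.
move=> fl fc.
pose F : {linear H -> H} := HB.pack f (GRing.isLinear.Build _ _ _ _ f fl).
move/(@linear_bounded_continuous _ _ _ F)/linear_boundedP : (fc) => fb.
have [M M0 fM] : exists2 M : R[i], 0 < M & forall x : H, `|f x| <= M * `|x|.
  near +oo_R[i] => M; exists M => //; near: M; exact: fb.
have f1 v : `|v| <= 1 -> complex.Re `|f v| <= opnorm f.
  move=> v1; apply: ub_le_sup; last by exists v.
  exists (complex.Re M) => _ [w /= w1 <-].
  have MR : (complex.Re M)%:C = M by rewrite RRe_real// gtr0_real.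
  by rewrite -lecR Re_norm MR (le_trans (fM w))// ler_piMr// ltW.
have [->|u0] := eqVneq u 0.
  by rewrite -[f]/(F : H -> H) linear0 !normr0 mulr0.
pose d := (complex.Re `|u|)^-1.
have Reu : 0 < complex.Re `|u| by rewrite -ltcR Re_norm normr_gt0.
have -> : f u = (complex.Re `|u|)%:C *: f (d%:C *: u).
  rewrite -[f]/(F : H -> H) linearZ scalerA -rmorphM/= mulfV ?gt_eqF//.
  by rewrite scale1r.
have E : complex.Re `|(complex.Re `|u|)%:C| = complex.Re `|u|.
  by rewrite ger0_norm// Re_norm normr_ge0.
rewrite Re_normZ E mulrC ler_wpM2r ?(ltW Reu)//; apply: f1.
rewrite normrZ ger0_norm ?lecR ?invr_ge0 ?(ltW Reu)//.
by rewrite -(Re_norm u) -rmorphM/= mulVf// gt_eqF.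
Unshelve. all: by end_near. Qed.

Lemma opnorm_ge0 H (f : H -> H) : linear f -> continuous f -> 0 <= opnorm f.
Proof.
move=> fl fc.
pose F : {linear H -> H} := HB.pack f (GRing.isLinear.Build _ _ _ _ f fl).
have [M0|M0] := leP 0 (opnorm f) => //.
have f0 (u : H) : u = 0.
  apply/eqP; apply: contraTT M0 => u0; rewrite -leNgt.
  have := opnorm_ub u fl fc.
  have Reu : 0 < complex.Re `|u| by rewrite -ltcR Re_norm normr_gt0.
  move=> h; rewrite -(pmulr_lge0 _ Reu); apply: le_trans h.
  by rewrite -lecR Re_norm normr_ge0.
suff : complex.Re `|f 0| <= opnorm f by rewrite (f0 (f 0)) normr0 leNgt M0.
apply: ub_le_sup; last by exists 0; rewrite //= normr0 ler01.
by exists 0 => _ [v _ <-]; rewrite (f0 (f v)) normr0.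
Qed.

Lemma compact_operator0 H : compact_operator (\0 : H -> H).
Proof.
split; first exact: linearP.
- by move=> x; exact: cvg_cst.
- exists [set 0]; first by move=> _ [u _ <-].
  by split; [exact: compact_set1|apply: compact_closed; [exact: norm_hausdorff|exact: compact_set1]].
Qed.

Lemma compact_operatorD H (f g : H -> H) :
  compact_operator f -> compact_operator g -> compact_operator (f \+ g).
Proof.
move=> [fl fc [A fA [Ac _]]] [gl gc [B gB [Bc _]]]; split.
- by move=> c u v /=; rewrite fl gl scalerDr !addrA; congr (_ + _); rewrite addrAC.
- by move=> x; apply: cvgD; [exact: fc|exact: gc].
- have sc : compact ((fun p : H * H => p.1 + p.2) @` (A `*` B)).
    apply: continuous_compact; last exact: compact_setX.
    by apply: continuous_subspaceT => x; exact: add_continuous.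
  exists ((fun p : H * H => p.1 + p.2) @` (A `*` B)).
    move=> _ [u u1 <-]; exists (f u, g u) => //.
    by split; [apply: fA; exists u|apply: gB; exists u].
  by split => //; apply: compact_closed => //; exact: norm_hausdorff.
Qed.

Lemma compact_operator_comp H (f g : H -> H) : linear f -> continuous f ->
  compact_operator g -> compact_operator (f \o g).
Proof.
move=> fl fc [gl gc [B gB [Bc _]]]; split.
- by move=> c u v /=; rewrite gl fl.
- by move=> x; apply: continuous_comp; [exact: gc|exact: fc].
- have fB : compact (f @` B).
    by apply: continuous_compact => //; exact: continuous_subspaceT.
  exists (f @` B); first by move=> _ [u u1 <-]; exists (g u) => //; apply: gB; exists u.
  by split => //; apply: compact_closed => //; exact: norm_hausdorff.
Qed.

Lemma compact_operatorZ H (c : R[i]) (f : H -> H) :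
  compact_operator f -> compact_operator (c \*: f).
Proof.
move=> fK; apply: (@compact_operator_comp H (fun u => c *: u)) => //.
- by move=> k u v; rewrite scalerDr !scalerA mulrC.
- exact: scaler_continuous.
Qed.

End BoundedOperators.

(* The underlying set of the c_0-direct sum of the algebras K(H_i): families
   (a_i) of compact operators such that for all e > 0 one has ||a_i|| < e for
   all but finitely many i. *)
Record c0sum (R : realType) (I : Type) (H : I -> hilbertSpace R) := C0sum {
  c0fun :> forall i, H i -> H i;
  c0_compact : forall i, compact_operator (@c0fun i);
  c0_vanish : forall e : R, 0 < e -> finite_set [set i | e <= opnorm (@c0fun i)]
}.

Arguments c0fun {R I H} _ i _.

Section C0sumAlgebra.
Context {R : realType} {I : Type} {H : I -> hilbertSpace R}.
Implicit Types a b : c0sum H.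

Let lin a i : linear (a i). Proof. by case: (c0_compact a i). Qed.
Let cont a i : continuous (a i). Proof. by case: (c0_compact a i). Qed.

Lemma c0sumP a b : (forall i, a i =1 b i) -> a = b.
Proof.
case: a b => [a a1 a2] [b b1 b2] /= ab.
have E : a = b by apply: functional_extensionality_dep => i; apply/funext.
by subst b; congr C0sum; exact: Prop_irrelevance.
Qed.

HB.instance Definition _ := gen_eqMixin (c0sum H).
HB.instance Definition _ := gen_choiceMixin (c0sum H).

Program Definition c0sum_zero : c0sum H := @C0sum _ _ _ (fun i => \0) _ _.
Next Obligation. by move=> i; exact: compact_operator0. Qed.
Next Obligation.
move=> e e0; apply: (@sub_finite_set _ _ set0) => // i /=; apply/negP.
by rewrite -ltNge; apply: le_lt_trans e0; apply: opnorm_le => u _; rewrite normr0.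
Qed.

Program Definition c0sum_add a b : c0sum H :=
  @C0sum _ _ _ (fun i => a i \+ b i) _ _.
Next Obligation. by move=> a b i; apply: compact_operatorD; exact: c0_compact. Qed.
Next Obligation.
move=> a b e e0; have e20 : 0 < e / 2 by rewrite divr_gt0.
apply: sub_finite_set (_ : finite_set
  ([set i | e / 2 <= opnorm (a i)] `|` [set i | e / 2 <= opnorm (b i)])).
  move=> i /= ei; apply: contrapT => /not_orP[/negP + /negP].
  rewrite -!ltNge => ai bi; move: ei; apply/negP; rewrite -ltNge.
  apply: le_lt_trans (_ : opnorm (a i) + opnorm (b i) < e).
    apply: opnorm_le => u u1; rewrite (le_trans (Re_norm_leD _ _))// lerD//.
      rewrite (le_trans (opnorm_ub _ (@lin _ _) (@cont _ _)))// ler_piMr//.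
        exact: opnorm_ge0.
      by rewrite -lecR Re_norm.
    rewrite (le_trans (opnorm_ub _ (@lin _ _) (@cont _ _)))// ler_piMr//.
      exact: opnorm_ge0.
    by rewrite -lecR Re_norm.
  by rewrite [e]splitr ltrD.
by rewrite finite_setU; split; exact: c0_vanish.
Qed.

Program Definition c0sum_mul a b : c0sum H :=
  @C0sum _ _ _ (fun i => a i \o b i) _ _.
Next Obligation.
by move=> a b i; apply: compact_operator_comp => //; exact: c0_compact.
Qed.
Next Obligation.
move=> a b e e0.
apply: sub_finite_set (_ : finite_set
  ([set i | 1 <= opnorm (a i)] `|` [set i | e <= opnorm (b i)])).
  move=> i /= ei; apply: contrapT => /not_orP[/negP + /negP].
  rewrite -!ltNge => ai bi; move: ei; apply/negP; rewrite -ltNge.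
  apply: le_lt_trans bi; apply: opnorm_le => u u1 /=.
  rewrite (le_trans (opnorm_ub _ (@lin _ _) (@cont _ _)))//.
  have bu : complex.Re `|b i u| <= opnorm (b i).
    rewrite (le_trans (opnorm_ub _ (@lin _ _) (@cont _ _)))// ler_piMr//.
      exact: opnorm_ge0.
    by rewrite -lecR Re_norm.
  rewrite -[leRHS]mul1r; apply: ler_pM => //; last exact: ltW.
    exact: opnorm_ge0.
  by rewrite -lecR Re_norm normr_ge0.
by rewrite finite_setU; split; exact: c0_vanish.
Qed.

Program Definition c0sum_scale (c : R[i]) a : c0sum H :=
  @C0sum _ _ _ (fun i => c \*: a i) _ _.
Next Obligation. by move=> c a i; apply: compact_operatorZ; exact: c0_compact. Qed.
Next Obligation.
move=> c a e e0; pose d := complex.Re `|c| + 1.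
have c0 : 0 <= complex.Re `|c| by rewrite -lecR Re_norm normr_ge0.
have d0 : 0 < d by rewrite ltr_wpDl.
apply: sub_finite_set (_ : finite_set [set i | e / d <= opnorm (a i)]).
  move=> i /= ei; rewrite ler_pdivrMr// (le_trans ei)//.
  apply: opnorm_le => u u1 /=; rewrite Re_normZ mulrC ler_pM//.
  - by rewrite -lecR Re_norm normr_ge0.
  - rewrite (le_trans (opnorm_ub _ (@lin _ _) (@cont _ _)))// ler_piMr//.
      exact: opnorm_ge0.
    by rewrite -lecR Re_norm.
  - by rewrite lerDl.
by apply: c0_vanish; rewrite divr_gt0.
Qed.

Fact c0sum_addA : associative c0sum_add.
Proof. by move=> a b c; apply: c0sumP => i u /=; rewrite addrA. Qed.
Fact c0sum_addC : commutative c0sum_add.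
Proof. by move=> a b; apply: c0sumP => i u /=; rewrite addrC. Qed.
Fact c0sum_add0 : left_id c0sum_zero c0sum_add.
Proof. by move=> a; apply: c0sumP => i u /=; rewrite add0r. Qed.
Fact c0sum_addN : left_inverse c0sum_zero (c0sum_scale (-1)) c0sum_add.
Proof. by move=> a; apply: c0sumP => i u /=; rewrite scaleN1r addNr. Qed.

HB.instance Definition _ := GRing.isZmodule.Build (c0sum H)
  c0sum_addA c0sum_addC c0sum_add0 c0sum_addN.

Fact c0sum_scaleA c d a : c0sum_scale c (c0sum_scale d a) = c0sum_scale (c * d) a.
Proof. by apply: c0sumP => i u /=; rewrite scalerA. Qed.
Fact c0sum_scale1 : left_id 1 c0sum_scale.
Proof. by move=> a; apply: c0sumP => i u /=; rewrite scale1r. Qed.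
Fact c0sum_scaleDr : right_distributive c0sum_scale +%R.
Proof. by move=> c a b; apply: c0sumP => i u /=; rewrite scalerDr. Qed.
Fact c0sum_scaleDl a c d :
  c0sum_scale (c + d) a = c0sum_scale c a + c0sum_scale d a.
Proof. by apply: c0sumP => i u /=; rewrite scalerDl. Qed.

HB.instance Definition _ := GRing.Zmodule_isLmodule.Build R[i] (c0sum H)
  c0sum_scaleA c0sum_scale1 c0sum_scaleDr c0sum_scaleDl.

Definition c0sum_norm a : R := sup [set opnorm (a i) | i in [set: I]].

(* b = a^* *)
Definition c0sum_adjoint a b : Prop :=
  forall i (u v : H i), hs_dot _ (a i u) v = hs_dot _ u (b i v).

Definition c0sum_ge0 a : Prop := forall i (u : H i), 0 <= hs_dot _ (a i u) u.

End C0sumAlgebra.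

(* Right Hilbert modules over the c_0-sum of the K(H_i), with inner product
   linear in the second variable. *)
Record hilbertModule (R : realType) (I : Type) (H : I -> hilbertSpace R) :=
  HilbertModule {
  hm_sort :> completeNormedModType R[i];
  act : {bilinear hm_sort -> c0sum H -> hm_sort | *:%R & *:%R};
  actA : forall x a b, act (act x a) b = act x (c0sum_mul a b);
  inner : hm_sort -> hm_sort -> c0sum H;
  inner_linear : forall x, linear (inner x);
  inner_act : forall x y a, inner x (act y a) = c0sum_mul (inner x y) a;
  inner_adjoint : forall x y, c0sum_adjoint (inner x y) (inner y x);
  inner_ge0 : forall x, c0sum_ge0 (inner x x);
  inner_eq0 : forall x, inner x x = 0 -> x = 0;
  inner_norm : forall x : hm_sort, `|x| ^+ 2 = (c0sum_norm (inner x x))%:C }.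

Arguments act {R I H h}.

(* Partially defined operators are represented by their graphs, so that
   inclusion and equality of sets of pairs are the inclusion and equality of
   operators (domains included), and the closure of an operator is the closure
   of its graph. *)
Section Operators.
Context {R : realType} {I : Type} {H : I -> hilbertSpace R}.
Implicit Types X Y Z : hilbertModule H.

Definition dom X Y (t : set (X * Y)) : set X := fst @` t.
Definition ran X Y (t : set (X * Y)) : set Y := snd @` t.

(* t is the graph of a c0sum H-linear map defined on a submodule of X. *)
Record operator X Y (t : set (X * Y)) : Prop := Operator {
  op_fun : forall x y y', t (x, y) -> t (x, y') -> y = y';
  op0 : t (0, 0);
  op_linear : forall (c : R[i]) x y x' y',
    t (x, y) -> t (x', y') -> t (c *: x + x', c *: y + y');
  op_act : forall x y a, t (x, y) -> t (act x a, act y a) }.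

(* ts: first s, then t. *)
Definition opcomp X Y Z (t : set (Y * Z)) (s : set (X * Y)) : set (X * Z) :=
  (t \; s)%relation.

Definition adj X Y (t : set (X * Y)) : set (Y * X) :=
  [set yz | forall x tx, t (x, tx) -> inner tx yz.1 = inner x yz.2].

Definition densely_defined X Y (t : set (X * Y)) : Prop := dense (dom t).

(* The last condition is the density of Ran (1 + t^* t). *)
Definition regular X Y (t : set (X * Y)) : Prop :=
  [/\ operator t, densely_defined t, closed t, densely_defined (adj t) &
      dense [set p.1 + p.2 | p in opcomp (adj t) t]].

Definition mp_inverse X Y (t : set (X * Y)) (s : set (Y * X)) : Prop :=
  [/\ regular t, regular s,
      opcomp (opcomp t s) t = t /\ opcomp (opcomp s t) s = s,
      adj (opcomp t s) = closure (opcomp t s) &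
      adj (opcomp s t) = closure (opcomp s t)].

(* t^dagger, with junk value set0 (which is not an operator) if t has no
   Moore-Penrose inverse. *)
Definition mpinv X Y (t : set (X * Y)) : set (Y * X) := xget set0 (mp_inverse t).

Definition graph X Y (S : X -> Y) : set (X * Y) := [set p | p.2 = S p.1].

Definition bounded_adjointable X (S : X -> X) : Prop :=
  [/\ linear S, forall x a, S (act x a) = act (S x) a,
      exists M : R[i], forall x, `|S x| <= M * `|x| &
      exists S' : X -> X, forall x y, inner (S x) y = inner x (S' y)].

End Operators.

Infix "**" := opcomp (at level 40, left associativity) : ring_scope.

(* Main.v *)
Require Import Defs.
From HB Require Import structures.
From mathcomp Require Import all_boot all_order all_algebra.
From mathcomp Require Import all_classical all_reals all_analysis.
From mathcomp Require Import sesquilinear complex.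
From mathcomp Require Import ring lra.

(* The key fact is that closed submodules M of Hilbert modules over c_0-sums of
   algebras of compact operators are orthogonally complemented. If e is the
   rank-one projection onto C w, the vectors x e form a Hilbert space for the
   scalar product <<x, y> w, w>, in which the nearest point argument gives
   x e \in M + M^perp. Finite-rank projections being sums of rank-one ones, and
   since <x, x> is compact, every x is a limit of vectors x e with e of finite
   rank; as M + M^perp is closed, it is everything.
   Applied to the graph of t, this decomposes X * Y into the graph of t and a
   rotated graph of t^*. Hence t^** = t, t^* is densely defined, 1 + t^* t is
   onto and t^* t is self-adjoint. The operator t x1 + x3 |-> x1, with x1
   orthogonal to Ker t and x3 in Ker t^*, is then the unique Moore-Penrose
   inverse, and (a), (b), (d) and (e) are computations with graphs; in (e), the
   closure of t^dagger t acts as the identity on Ran t^*, so that the right-hand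
   side is t^*. For (c), a closed range makes t^dagger everywhere defined; by
   uniform boundedness so is its adjoint, whence Ran t^* = (Ker t)^perp. *)

Set Implicit Arguments.
Unset Strict Implicit.
Unset Printing Implicit Defensive.

Import Order.TTheory GRing.Theory Num.Theory.
Import numFieldNormedType.Exports.

Local Open Scope classical_set_scope.
Local Open Scope ring_scope.
Local Open Scope complex_scope.

(** * Real forms and norms *)

(** Over a general C*-algebra a closed submodule need not be complemented: the norm of a Hilbert
    module satisfies no parallelogram law, so a minimizing sequence need not converge. What rescues
    the argument here is that a minimal projection e satisfies e A e = C e, so that on vectors x e
    the inner product is essentially scalar. The analytic steps therefore pass through the real
    forms [phi u x y], the real part of <<x, y> u, u>. They are symmetric and semidefinite, and
    together they determine [inner] by polarization. Since [mpinv] is a choice among Moore-Penrose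
    inverses, an explicit graph can replace it only once existence and uniqueness are both known. In
    (c) what has to be gained is an inclusion of domains: each x orthogonal to Ker t must be of the
    form t^* w, and w is found as the value at x of the adjoint of t^dagger. *)

Lemma discriminant_le (R : realFieldType) (p q r : R) : 0 <= r ->
  (forall s, 0 <= p + 2 * s * q + s ^+ 2 * r) -> q ^+ 2 <= p * r.
Proof.
move=> r0 pqr; have [r_eq0|rN0] := eqVneq r 0.
  have [->|qN0] := eqVneq q 0; first by rewrite r_eq0; lra.
  (* For [r = 0] the polynomial is affine in [s], and this [s] gives it the value -1. *)
  have := pqr (- (p + 1) / (2 * q)); rewrite r_eq0 mulr0 addr0.
  have -> : 2 * (- (p + 1) / (2 * q)) * q = - (p + 1) by field.
  by lra.
have rgt0 : 0 < r by rewrite lt_def rN0.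
have := pqr (- q / r).
have -> : p + 2 * (- q / r) * q + (- q / r) ^+ 2 * r = (p * r - q ^+ 2) / r.
  by field.
by rewrite pmulr_lge0 ?invr_gt0// subr_ge0.
Qed.

Lemma Re_RM (R : realType) (c : R) (z : R[i]) :
  complex.Re (c%:C * z) = c * complex.Re z.
Proof. by case: z => a b; simpc. Qed.

Lemma ReJ (R : realType) (z : R[i]) : complex.Re (z^*)%C = complex.Re z.
Proof. by case: z. Qed.

Lemma ReD (R : realType) (z w : R[i]) :
  complex.Re (z + w) = complex.Re z + complex.Re w.
Proof. by case: z => a b; case: w => c d. Qed.

(** Only real scalars are involved: real parts of sesquilinear forms are symmetric, and
    Cauchy-Schwarz becomes a real discriminant. Imaginary parts are recovered later through
    multiplication by i. *)
Record psd_form (R : realType) (V : lmodType R[i]) (b : V -> V -> R) : Prop :=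
  PsdForm {
  psdD : forall x y z, b x (y + z) = b x y + b x z;
  psdZ : forall (c : R) x y, b x (c%:C *: y) = c * b x y;
  psdC : forall x y, b x y = b y x;
  psd_ge0 : forall x, 0 <= b x x }.

Section PsdForm.
Context (R : realType) (V : lmodType R[i]) (b : V -> V -> R).
Context (bP : psd_form b).

Lemma psdN x y : b x (- y) = - b x y.
Proof.
by rewrite -[- y]scaleN1r -[-1](rmorphN1 (real_complex R)) psdZ// mulN1r.
Qed.

Lemma psdB x y z : b x (y - z) = b x y - b x z.
Proof. by rewrite psdD// psdN. Qed.

Lemma psdDl x y z : b (y + z) x = b y x + b z x.
Proof. by rewrite psdC// psdD// !(psdC bP x). Qed.

Lemma psdNl x y : b (- y) x = - b y x.
Proof. by rewrite psdC// psdN// psdC. Qed.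

Lemma psdBl x y z : b (y - z) x = b y x - b z x.
Proof. by rewrite psdDl psdNl. Qed.

Lemma psdZl (c : R) x y : b (c%:C *: y) x = c * b y x.
Proof. by rewrite psdC// psdZ// psdC. Qed.

Lemma psd_CS x y : b x y ^+ 2 <= b x x * b y y.
Proof.
apply: discriminant_le => [|s]; first exact: psd_ge0.
have := psd_ge0 bP (x + s%:C *: y).
rewrite psdD// !psdDl// !psdZ// !psdZl (psdC bP y x).
by congr (_ <= _); ring.
Qed.

Lemma psd_parallelogram x y :
  b (x - y) (x - y) + b (x + y) (x + y) = 2 * b x x + 2 * b y y.
Proof. by rewrite psdB// psdD// !psdBl// !psdDl// (psdC bP y x); ring. Qed.

End PsdForm.

Definition nm (R : realType) (V : normedModType R[i]) (x : V) : R :=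
  complex.Re `|x|.

Section RealNorm.
Context (R : realType) (V : normedModType R[i]).
Implicit Types x y : V.

Lemma nmE x : (nm x)%:C = `|x|. Proof. exact: Re_norm. Qed.

Lemma nm_ge0 x : 0 <= nm x.
Proof. by rewrite -lecR nmE normr_ge0. Qed.

Lemma nmD x y : nm (x + y) <= nm x + nm y. Proof. exact: Re_norm_leD. Qed.

Lemma nmN x : nm (- x) = nm x. Proof. by rewrite /nm normrN. Qed.

Lemma nm_eq0 x : (nm x == 0) = (x == 0).
Proof. by rewrite -(normr_eq0 x) -nmE (inj_eq (@complexI R)). Qed.

Lemma nm_gt0 x : (0 < nm x) = (x != 0).
Proof. by rewrite lt_def nm_eq0 nm_ge0 andbT. Qed.

Lemma nmZ (c : R) x : nm (c%:C *: x) = `|c| * nm x.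
Proof.
apply: (@complexI R); rewrite nmE normrZ rmorphM/= nmE; congr (_ * _).
by rewrite normc_def/= expr0n addr0 sqrtr_sqr.
Qed.

Lemma nm_ball x (e : R) y : 0 < e -> ball x e%:C y = (nm (x - y) < e) :> Prop.
Proof. by move=> e0; rewrite -ball_normE /ball_/= -ltcR nmE. Qed.

Lemma nbhs_nm x (A : set V) :
  nbhs x A <-> exists2 e : R, 0 < e & forall y, nm (x - y) < e -> A y.
Proof.
split=> [/nbhs_ballP[e e0 eA]|[e e0 eA]].
  have eE : (complex.Re e)%:C = e by rewrite RRe_real// gtr0_real.
  have e1 : 0 < complex.Re e by rewrite -ltcR eE.
  by exists (complex.Re e) => // y xy; apply: eA; rewrite -eE nm_ball.
apply/nbhs_ballP; exists e%:C; first by rewrite /= ltcR.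
by move=> y; rewrite nm_ball//; exact: eA.
Qed.

Lemma closure_nm (A : set V) x :
  closure A x <-> forall e : R, 0 < e -> exists2 y, A y & nm (x - y) < e.
Proof.
split=> [cl e e0|cl B /nbhs_nm[e e0 eB]].
  have /cl[y [Ay xy]] : nbhs x (fun y => nm (x - y) < e).
    by apply/nbhs_nm; exists e.
  by exists y.
by have [y Ay xy] := cl _ e0; exists y; split => //; exact: eB.
Qed.

Lemma dense_nm (A : set V) :
  dense A <-> forall x (e : R), 0 < e -> exists2 y, A y & nm (x - y) < e.
Proof.
rewrite (_ : dense A <-> forall x, closure A x); last first.
  split=> [dA x B Bx|clA O [x Ox] Oo].
    have [|y [By Ay]] := dA (B°) _ (open_interior B).
      by exists x; exact: Bx.
    by exists y; split => //; exact: interior_subset.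
  have [|y [Ay Oy]] := clA x O; first exact: open_nbhs_nbhs.
  by exists y.
by split=> h x; apply/closure_nm; exact: h.
Qed.

End RealNorm.

Lemma closure_nm2 (R : realType) (V W : normedModType R[i]) (A : set (V * W)) p :
  closure A p <-> forall e : R, 0 < e ->
    exists2 q, A q & nm (p.1 - q.1) < e /\ nm (p.2 - q.2) < e.
Proof.
have maxE (q : V * W) (e : R) : (nm q < e) = (nm q.1 < e) && (nm q.2 < e).
  rewrite -!ltcR !nmE prod_normE comparable_gt_max//.
  by rewrite real_comparable ?normr_real.
rewrite closure_nm; split => h e /h[q Aq].
  by rewrite maxE => /andP[q1 q2]; exists q.
by move=> [q1 q2]; exists q => //; rewrite maxE q1.
Qed.

Lemma nm_complete (R : realType) (V : completeNormedModType R[i])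
    (u : nat -> V) :
  (forall e : R, 0 < e -> exists N, forall n k, (N <= n)%N -> (N <= k)%N ->
     nm (u n - u k) < e) ->
  exists l, forall e : R, 0 < e ->
    exists N, forall n, (N <= n)%N -> nm (u n - l) < e.
Proof.
move=> uC.
have : cauchy (u @ \oo).
  apply/cauchy_exP => e e0.
  have eE : (complex.Re e)%:C = e by rewrite RRe_real// gtr0_real.
  have e1 : 0 < complex.Re e by rewrite -ltcR eE.
  have [N uN] := uC _ e1.
  exists (u N); exists N => // n /= Nn.
  by rewrite -eE nm_ball//; exact: uN.
move/cauchy_cvg/cvg_ex => [l ul]; exists l => e e0.
have /ul[N _ uN] : nbhs l (fun y => nm (l - y) < e) by apply/nbhs_nm; exists e.
by exists N => n Nn; rewrite -nmN opprB; exact: uN.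
Qed.

Section HilbertDot.
Context (R : realType) (H : hilbertSpace R).
Implicit Types u v w : H.
Local Notation dot := (hs_dot H).

Lemma dotC u v : dot u v = ((dot v u)^*)%C.
Proof. by rewrite (hermC (hs_dot H)) expr0 mul1r. Qed.

Lemma dotDl u v w : dot (u + v) w = dot u w + dot v w.
Proof. exact: linearDl. Qed.

Lemma dotDr u v w : dot u (v + w) = dot u v + dot u w.
Proof. exact: linearDr. Qed.

Lemma dotZl c u v : dot (c *: u) v = c * dot u v.
Proof. exact: linearZl_LR. Qed.

Lemma dotZr c u v : dot u (c *: v) = (c^*)%C * dot u v.
Proof. exact: linearZr_LR. Qed.

Lemma dot0l u : dot 0 u = 0.
Proof. exact: linear0l. Qed.

Lemma dot0r u : dot u 0 = 0.
Proof. exact: linear0r. Qed.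

Lemma dot_self u : dot u u = (nm u ^+ 2)%:C.
Proof. by rewrite -hs_normE -nmE rmorphXn. Qed.

Lemma dot_eq0 u : dot u u = 0 -> u = 0.
Proof.
by move/eqP; rewrite dot_self -[0]/(0%:C) (inj_eq (@complexI R)) sqrf_eq0 nm_eq0 => /eqP.
Qed.

Definition rdot u v : R := complex.Re (dot u v).

Lemma psd_rdot : psd_form rdot.
Proof.
split=> [x y z|c x y|x y|x]; rewrite /rdot.
- by rewrite dotDr ReD.
- by rewrite dotZr conjc_real Re_RM.
- by rewrite dotC ReJ.
- by rewrite dot_self/= sqr_ge0.
Qed.

Lemma rdot_self u : rdot u u = nm u ^+ 2.
Proof. by rewrite /rdot dot_self. Qed.

Lemma rdot_CS u v : rdot u v <= nm u * nm v.
Proof.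
have := psd_CS psd_rdot u v; rewrite !rdot_self -exprMn => h.
have [|r0] := lerP (rdot u v) 0; first by move/le_trans; apply; rewrite mulr_ge0 ?nm_ge0.
by rewrite -ler_sqr ?nnegrE ?(ltW r0) ?mulr_ge0 ?nm_ge0.
Qed.

Lemma normr_dot u v : complex.Re `|dot u v| <= nm u * nm v.
Proof.
set c := dot u v; have [c0|cN0] := eqVneq c 0.
  by rewrite c0 normr0 mulr_ge0 ?nm_ge0.
have [r rE] : exists r : R, r%:C = `|c| by eexists; exact: Re_norm.
have r0 : 0 < r by rewrite -ltcR rE normr_gt0.
(* The unimodular factor [c / r] turns the dot product into its modulus, so the bound on real parts
   suffices. *)
have := rdot_CS u ((r^-1)%:C *: (c *: v)).
have -> : nm ((r^-1)%:C *: (c *: v)) = nm v.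
  rewrite nmZ gtr0_norm ?invr_gt0// /nm normrZ -rE Re_RM mulrA mulVf ?mul1r//.
  by rewrite gt_eqF.
rewrite (psdZ psd_rdot) /rdot dotZr -/c mulrC (mulrC _ c) -sqr_normc -rE.
by rewrite -rmorphXn/= expr2 mulfK ?gt_eqF.
Qed.

End HilbertDot.

(** * Quadratic forms and norms in the c_0-sum *)

Section Quadratic.
Context (R : realType) (I : Type) (H : I -> hilbertSpace R).
Implicit Types a b : c0sum H.

Lemma c0lin a i : linear (a i). Proof. by case: (c0_compact a i). Qed.

Lemma c0cont a i : continuous (a i). Proof. by case: (c0_compact a i). Qed.

Definition c0linear a i : {linear H i -> H i} :=
  HB.pack (a i) (GRing.isLinear.Build _ _ _ _ (a i) (@c0lin a i)).

Lemma c0D a i u v : a i (u + v) = a i u + a i v.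
Proof. exact: (linearD (c0linear a i)). Qed.
Lemma c0B a i u v : a i (u - v) = a i u - a i v.
Proof. exact: (linearB (c0linear a i)). Qed.
Lemma c0Z a i c u : a i (c *: u) = c *: a i u.
Proof. exact: (linearZZ (c0linear a i)). Qed.
Lemma c00 a i : a i 0 = 0.
Proof. exact: (linear0 (c0linear a i)). Qed.

Lemma c0addE a b i u : (a + b) i u = a i u + b i u. Proof. by []. Qed.
Lemma c0scaleE c a i u : (c *: a) i u = c *: a i u. Proof. by []. Qed.
Lemma c0mulE a b i u : c0sum_mul a b i u = a i (b i u). Proof. by []. Qed.
Lemma c0zeroE i u : (0 : c0sum H) i u = 0. Proof. by []. Qed.

Lemma nm_c0_le a i u : nm (a i u) <= opnorm (a i) * nm u.
Proof. exact: opnorm_ub (@c0lin a i) (@c0cont a i). Qed.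

Definition qf a i (u : H i) : R := rdot (a i u) u.

Lemma qfD a b i (u : H i) : qf (a + b) u = qf a u + qf b u.
Proof. by rewrite /qf c0addE /rdot dotDl ReD. Qed.

Lemma qfZ (c : R) a i (u : H i) : qf (c%:C *: a) u = c * qf a u.
Proof. by rewrite /qf /rdot c0scaleE dotZl Re_RM. Qed.

(* A complex operator is determined by its quadratic form, by polarization;
   the hypothesis on ['i *: a] recovers the imaginary part. *)
Lemma qf_eq0 a : (forall i (u : H i), qf a u = 0) ->
  (forall i (u : H i), qf ('i *: a) u = 0) -> a = 0.
Proof.
move=> a0 ia0.
have d0 i (u : H i) : hs_dot (H i) (a i u) u = 0.
  have := a0 i u; have := ia0 i u; rewrite /qf /rdot c0scaleE dotZl mulrC ReiNIm.
  by case: (hs_dot _ _ _) => x y /= /eqP; rewrite oppr_eq0 => /eqP -> ->.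
apply: c0sumP => i u; rewrite c0zeroE.
pose v := a i u.
have pol w : hs_dot (H i) (a i u) w + hs_dot (H i) (a i w) u = 0.
  have := d0 i (u + w); rewrite c0D dotDl !dotDr !d0 add0r addr0.
  by [].
(* At [v] and at i [v], polarization gives the sum and the difference of the two cross terms, so
   both vanish; for [v = a i u] one of them is the square of |a u|. *)
have := pol v; have := pol ('i *: v).
rewrite c0Z dotZl dotZr => h1 h2.
have h3 : hs_dot (H i) (a i v) u - hs_dot (H i) (a i u) v = 0.
  move: h1; have -> : ('i^*)%C = - 'i :> R[i].
    by apply/eqP; rewrite eq_complex/= oppr0 !eqxx.
  rewrite mulNr addrC -mulrBr => /eqP; rewrite mulf_eq0 => /orP[|/eqP//].
  by rewrite eq_complex/= oner_eq0 andbF.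
apply: dot_eq0; move: h2 => /eqP; rewrite addr_eq0 => /eqP h2.
move: h3; rewrite h2 -/v => /eqP; rewrite subr_eq0 -addr_eq0 -mulr2n.
by rewrite mulrn_eq0/= => /eqP ->; rewrite oppr0.
Qed.

Definition positive a := c0sum_ge0 a /\ c0sum_adjoint a a.

Lemma psd_c0 a i : positive a -> psd_form (fun u v => rdot (a i u) v).
Proof.
move=> [a0 aa]; split=> [x y z|c x y|x y|x].
- exact: psdD (psd_rdot _) _ _ _.
- exact: psdZ (psd_rdot _) _ _ _.
- by rewrite (psdC (psd_rdot _)) /rdot aa.
- by have := a0 i x; rewrite lecE => /andP[].
Qed.

Lemma qf_scale a i (c : R) (u : H i) : qf a (c%:C *: u) = c ^+ 2 * qf a u.
Proof. by rewrite /qf c0Z /rdot dotZl dotZr conjc_real !Re_RM mulrA expr2. Qed.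

Lemma qf_bound a i (c : R) (u : H i) : (forall v : H i, nm v <= 1 -> qf a v <= c) ->
  qf a u <= c * nm u ^+ 2.
Proof.
move=> ac; have [->|uN0] := eqVneq u 0.
  by rewrite /qf c00 /rdot dot0l /= /nm normr0/= expr0n mulr0.
have u0 : 0 < nm u by rewrite nm_gt0.
have := ac ((nm u)^-1%:C *: u); rewrite nmZ gtr0_norm ?invr_gt0// mulVf ?gt_eqF//.
move=> /(_ (lexx _)); rewrite qf_scale exprVn mulrC.
by rewrite ler_pdivrMr ?exprn_gt0.
Qed.

(** Cauchy-Schwarz for the form <a u, v> at v = a u gives |v|^4 <= c (c |v|^2). *)
Lemma opnorm_positive_le a i (c : R) : positive a ->
  (forall u : H i, nm u <= 1 -> qf a u <= c) -> opnorm (a i) <= c.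
Proof.
move=> ap ac.
have c0 : 0 <= c.
  have := ac 0; rewrite /qf c00 /rdot dot0l /=; apply.
  by rewrite /nm normr0/= ler01.
apply: opnorm_le => u u1; rewrite -/(nm _).
have {}u1 : nm u <= 1 by rewrite -lecR nmE.
set v := a i u.
have := psd_CS (psd_c0 i ap) u v; rewrite -/v rdot_self.
have qu : qf a u <= c by exact: ac.
have qv : qf a v <= c * nm v ^+ 2 by exact: qf_bound.
rewrite -/(qf a u) -/(qf a v) => h.
have [->|vN0] := eqVneq v 0; first by rewrite /nm normr0.
have v0 : 0 < nm v ^+ 2 by rewrite exprn_gt0// nm_gt0.
rewrite -ler_sqr ?nnegrE ?nm_ge0//.
rewrite -(ler_pM2r v0) -expr2 (le_trans h)// expr2 -mulrA ler_pM//.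
- exact: psd_ge0 (psd_c0 i ap) _.
- exact: psd_ge0 (psd_c0 i ap) _.
Qed.

Lemma qf_le_opnorm a i (u : H i) : qf a u <= opnorm (a i) * nm u ^+ 2.
Proof.
rewrite (le_trans (rdot_CS _ _))// expr2 mulrA ler_wpM2r ?nm_ge0//.
exact: nm_c0_le.
Qed.

(** Membership is [List.In] because index types carry no decidable equality. *)
Lemma finite_set_seq (T : Type) (A : set T) : finite_set A ->
  exists s : seq T, forall x, A x -> List.In x s.
Proof.
move=> /(@finite_seqP {classic T})[s ->]; exists s => x /=.
by elim: s => //= y s ih; rewrite in_cons => /orP[/eqP ->|/ih]; [left|right].
Qed.

Lemma opnorm_le_c0sum_norm a i : opnorm (a i) <= c0sum_norm a.
Proof.
apply: ub_le_sup; last by exists i.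
have [s sP] := finite_set_seq (c0_vanish a ltr01).
(* All but finitely many of the norms are below 1, and the others are bounded by their sum. *)
exists (1 + \sum_(j <- s) opnorm (a j)) => _ [j _ <-].
have o0 k : 0 <= opnorm (a k) by apply: opnorm_ge0; [exact: c0lin|exact: c0cont].
have [j1|/ltW j1] := lerP 1 (opnorm (a j)); last first.
  by rewrite (le_trans j1)// lerDl sumr_ge0.
rewrite (@le_trans _ _ (\sum_(k <- s) opnorm (a k)))//; last by rewrite lerDr.
have := sP j j1; elim: s {sP} => //= k s ih [->|/ih js]; rewrite big_cons.
  by rewrite lerDl sumr_ge0.
by rewrite (le_trans js)// lerDr.
Qed.

Lemma c0sum_norm_le a (c : R) : 0 <= c ->
  (forall i, opnorm (a i) <= c) -> c0sum_norm a <= c.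
Proof.
move=> c0 ac.
(* For empty [I] the supremum takes its default value 0, and [0 <= c] concludes. *)
have [E|/set0P E] := eqVneq [set opnorm (a i) | i in [set: I]] set0.
  by rewrite /c0sum_norm E sup0.
by apply: ge_sup => // _ [i _ <-].
Qed.

End Quadratic.

Lemma compact_net (R : realType) (V : normedModType R[i]) (A : set V) (e : R) :
  compact A -> 0 < e ->
  exists s : seq V, forall x, A x -> exists2 y, List.In y s & nm (x - y) < e.
Proof.
rewrite compact_cover => Ac e0.
have [y _|x Ax|D _ AD] := Ac V setT (fun y => ball y e%:C).
- exact: ball_open.
- by exists x => //; apply: ballxx; rewrite ltcR.
exists (finmap.enum_fset D) => x /AD[y /= yD yx].
exists y; last by rewrite -nmN opprB; move: yx; rewrite nm_ball.
have : y \in finmap.enum_fset D by exact: yD.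
elim: (finmap.enum_fset D) => //= z s ih.
by rewrite in_cons => /orP[/eqP ->|/ih]; [left|right].
Qed.

Lemma nm_orth_le (R : realType) (H : hilbertSpace R) (z t : H) :
  rdot z t = 0 -> nm z <= nm (z + t).
Proof.
move=> zt; rewrite -ler_sqr ?nnegrE ?nm_ge0// -!rdot_self.
have P := psd_rdot H.
rewrite (psdD P) !(psdDl P) (psdC P t z) zt addr0 add0r lerDl.
exact: psd_ge0 P _.
Qed.

(** * Finite-rank projections *)

Section RankOne.
Context (R : realType) (I : Type) (H : I -> hilbertSpace R).

(** The spaces depend on the index, so [w] has to be transported along a classically decided
    equality [i = j]. *)
Definition single (i : I) (w : H i) (j : I) : H j :=
  match pselect (i = j) with
  | left e => eq_rect i (fun k => hs_sort (H k)) w j e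
  | right _ => 0
  end.

Lemma single_eq i (w : H i) : single w i = w.
Proof.
rewrite /single; case: pselect => // e.
by rewrite (Prop_irrelevance e erefl).
Qed.

Lemma single_neq i (w : H i) j : i <> j -> single w j = 0.
Proof. by rewrite /single; case: pselect. Qed.

Lemma dot_single_self i (w : H i) j :
  hs_dot (H j) (single w j) (single w j) *: single w j
  = hs_dot (H i) w w *: single w j.
Proof.
have [<-|ij] := pselect (i = j); first by rewrite single_eq.
by rewrite single_neq// !scaler0.
Qed.

(** Unnormalised: at index [i] this is |w|^2 times the projection onto C w, which still makes sense
    for w = 0. *)
Definition rank1 i (w : H i) j (u : H j) : H j :=
  hs_dot (H j) u (single w j) *: single w j.

Fact rank1_compact i (w : H i) j : compact_operator (rank1 w (j := j)).
Proof.
set v := single w j.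
have lin : linear (rank1 w (j := j)).
  by move=> c x y; rewrite /rank1 dotDl dotZl scalerDl scalerA.
pose F : {linear H j -> H j} := HB.pack (rank1 w (j := j))
  (GRing.isLinear.Build _ _ _ _ _ lin).
have Fle x : nm (F x) <= nm x * nm v ^+ 2.
  rewrite /= /rank1 -/v /nm normrZ.
  rewrite -(Re_norm (hs_dot _ _ _)) Re_RM expr2 mulrA ler_wpM2r ?nm_ge0//.
  exact: normr_dot.
split => //.
- apply: (linear_bounded_continuous F).1; apply/linear_boundedP.
  near=> M => x.
  have ME : (complex.Re M)%:C = M.
    by rewrite RRe_real// gtr0_real//; near: M; exact: nbhs_pinfty_gt.
  have MR : nm v ^+ 2 <= complex.Re M.
    rewrite -lecR ME; near: M; apply: nbhs_pinfty_ge.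
    by rewrite complex_real.
  rewrite -ME -!nmE -rmorphM lecR (le_trans (Fle x))// mulrC.
  by rewrite ler_wpM2r ?nm_ge0.
(* The unit ball is mapped into the image under [g] of a closed square, whose half-side |v| bounds
   the coefficients by Cauchy-Schwarz. *)
- pose g (p : R * R) : H j := (p.1 +i* p.2) *: v.
  pose K := nm v.
  have gc : continuous g.
    move=> p; apply/(@cvgrPdist_lt _ (H j)) => e e0.
    have eE : (complex.Re e)%:C = e by rewrite RRe_real// gtr0_real.
    have e1 : 0 < complex.Re e by rewrite -ltcR eE.
    pose d := complex.Re e / (2 * (nm v + 1)).
    have v1 : 0 < nm v + 1 by rewrite ltr_wpDl ?nm_ge0.
    have d0 : 0 < d by rewrite divr_gt0// mulr_gt0.
    near=> q.
    have q1 : `|p.1 - q.1| < d.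
      near: q; apply: (@cvgr_dist_lt _ _ _ _ _ (fun q : R * R => q.1)) => //.
      exact: cvg_fst.
    have q2 : `|p.2 - q.2| < d.
      near: q; apply: (@cvgr_dist_lt _ _ _ _ _ (fun q : R * R => q.2)) => //.
      exact: cvg_snd.
    rewrite -eE -nmE ltcR /g -scalerBl.
    have -> : (p.1 +i* p.2 - (q.1 +i* q.2) : R[i]) =
        (p.1 - q.1)%:C + 'i * (p.2 - q.2)%:C by simpc.
    rewrite scalerDl (le_lt_trans (nmD _ _))// nmZ.
    have -> : nm (('i * (p.2 - q.2)%:C) *: v) = `|p.2 - q.2| * nm v.
      rewrite -scalerA -nmZ /nm normrZ.
      have -> : `|'i%C : R[i]| = 1.
        by rewrite normc_def/= expr0n/= expr1n add0r sqrtr1.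
      by rewrite mul1r.
    have -> : complex.Re e = d * (nm v + 1) + d * (nm v + 1).
      by rewrite /d; field; rewrite gt_eqF.
    apply: ltr_leD.
      apply: (@le_lt_trans _ _ (d * nm v)).
        by rewrite ler_wpM2r ?nm_ge0// ltW.
      by rewrite ltr_pM2l ?ltrDl.
    by apply: ler_pM; rewrite ?nm_ge0 ?normr_ge0 ?lerDl// ltW.
  pose B := g @` (`[- K, K] `*` `[- K, K]).
  have Bc : compact B.
    apply: continuous_compact; first exact: continuous_subspaceT.
    by apply: compact_setX; exact: segment_compact.
  exists B; last by split => //; apply: compact_closed => //; exact: norm_hausdorff.
  move=> _ [u /= u1 <-]; rewrite /rank1 -/v.
  have : complex.Re `|hs_dot (H j) u v| <= K.
    rewrite (le_trans (normr_dot _ _))// ler_piMl ?nm_ge0//.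
    by rewrite -lecR nmE.
  case E : (hs_dot _ _ _) => [a b] abK; exists (a, b) => //.
  have sq x y : `|x| <= Num.sqrt (x ^+ 2 + y ^+ 2) :> R.
    by rewrite -sqrtr_sqr ler_wsqrtr// lerDl sqr_ge0.
  move: abK; rewrite normc_def/= => abK.
  split; rewrite /= in_itv/= -ler_norml (le_trans _ abK)//.
  by rewrite addrC.
Unshelve. all: by end_near. Qed.

Fact rank1_vanish i (w : H i) (e : R) : 0 < e ->
  finite_set [set j | e <= opnorm (rank1 w (j := j))].
Proof.
move=> e0; apply: (@sub_finite_set _ _ [set i]); last exact: finite_set1.
move=> j /= ej; apply: contrapT => ij; move: ej; apply/negP; rewrite -ltNge.
apply: le_lt_trans e0; apply: opnorm_le => u _.
by rewrite /rank1 single_neq ?scaler0 ?normr0// => /esym.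
Qed.

Definition rank1_c0 i (w : H i) : c0sum H :=
  C0sum (@rank1_compact i w) (@rank1_vanish i w).

Lemma rank1_c0E i (w : H i) j u : rank1_c0 w j u =
  hs_dot (H j) u (single w j) *: single w j.
Proof. by []. Qed.

Lemma rank1_adjoint i (w : H i) : c0sum_adjoint (rank1_c0 w) (rank1_c0 w).
Proof.
move=> j u v; rewrite !rank1_c0E dotZl dotZr -dotC.
by rewrite mulrC.
Qed.

Record projection (e : c0sum H) : Prop := Projection {
  proj_adj : c0sum_adjoint e e;
  proj_idem : forall j u, e j (e j u) = e j u }.

(* Gram-Schmidt: [e] is enlarged by the rank-one projection on [v - e v]. *)
Lemma finite_rank_projection (D : set (c0sum H)) :
  D 0 -> (forall (c : R[i]) a b, D a -> D b -> D (c *: a + b)) ->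
  (forall i (w : H i), D (rank1_c0 w)) ->
  forall s : seq {i : I & H i}, exists e, [/\ D e, projection e &
    forall p, List.In p s -> e (projT1 p) (projT2 p) = projT2 p].
Proof.
move=> D0 DD D1; elim=> [|[i v] s [e [De [ea ee] es]]].
  exists 0; split => //; split => [j x y|//].
  by rewrite !c0zeroE dot0l dot0r.
pose w := v - e i v.
have [w0|wN0] := eqVneq w 0.
  exists e; split => // p /= [<-/=|/es//].
  by apply/esym/eqP; rewrite -subr_eq0 -/w w0.
pose c := (hs_dot (H i) w w)^-1.
have dwN0 : hs_dot (H i) w w != 0 by apply: contra_neq wN0; exact: dot_eq0.
have cJ : (c^*)%C = c by rewrite /c conjc_inv dot_self conjc_real.
(* As [e] is idempotent it kills [w]; hence the new rank-one projection is orthogonal to [e] and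
   their sum is again a projection. *)
have ew j : e j (single w j) = 0.
  have [<-|ij] := pselect (i = j); last by rewrite single_neq ?c00.
  by rewrite single_eq c0B ee subrr.
have dew j x : hs_dot (H j) (e j x) (single w j) = 0.
  by rewrite ea ew dot0r.
exists (c *: rank1_c0 w + e); split; first exact: DD.
  split=> [j x y|j x]; rewrite !c0addE !c0scaleE.
    rewrite dotDl dotDr dotZl dotZr cJ ea; congr (_ * _ + _).
    exact: rank1_adjoint.
  rewrite !rank1_c0E !(c0D, c0Z) dotDl !dotZl dew addr0 ew !scaler0 add0r ee.
  rewrite mulrA -[(c * _ * _) *: _]scalerA dot_single_self !scalerA.
  by congr (_ *: _ + _); rewrite /c; field.
have fix_v : (c *: rank1_c0 w + e) i v = v.
  rewrite c0addE c0scaleE rank1_c0E single_eq (_ : hs_dot _ v w = hs_dot _ w w).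
    by rewrite scalerA mulVf// scale1r subrK.
  have := dew i v; rewrite single_eq => evw.
  have vE : v = w + e i v by rewrite subrK.
  by rewrite {1}vE dotDl evw addr0.
move=> p [<-|ps]; first exact: fix_v.
rewrite c0addE c0scaleE rank1_c0E es//.
by rewrite -[in X in hs_dot _ X _](es _ ps) dew scale0r scaler0 add0r.
Qed.

Lemma nm_projB_le (e : c0sum H) i (x y : H i) : projection e -> e i y = y ->
  nm (x - e i x) <= nm (x - y).
Proof.
move=> [ea ee] ey; have -> : x - y = (x - e i x) + e i (x - y).
  by rewrite c0B ey addrA subrK.
by apply: nm_orth_le; rewrite /rdot -ea c0B ee subrr dot0l.
Qed.

(** Only finitely many components have norm at least [e]; for each of them [s] lists a finite net of
    the image of the unit ball. A projection fixing the net does at least as well as the net points,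
    since it yields the nearest point of its range. On the other components already 0 is a good
    enough approximation. *)
Lemma compact_finite_rank_approx (a : c0sum H) (e : R) : 0 < e ->
  exists s : seq {i : I & H i}, forall p, projection p ->
    (forall x, List.In x s -> p (projT1 x) (projT2 x) = projT2 x) ->
    forall i (u : H i), nm u <= 1 -> nm (a i u - p i (a i u)) <= e.
Proof.
move=> e0; have [l lP] := finite_set_seq (c0_vanish a e0).
pose pr i (y : H i) : {i : I & H i} := existT _ i y.
have net i : exists s : seq {i : I & H i}, forall u : H i, nm u <= 1 ->
    exists2 y : H i, List.In (pr i y) s & nm (a i u - y) < e.
  have [_ _ [B aB [Bc _]]] := c0_compact a i.
  have [s sP] := compact_net Bc e0.
  exists [seq pr i y | y <- s] => u u1.
  have /sP[y ys uy] : B (a i u) by apply: aB; exists u => //=; rewrite -nmE lecR.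
  exists y => //.
  by elim: s ys {sP} => //= z s ih [->|/ih]; [left|right].
have [f fP] := choice net.
exists (flatten [seq f i | i <- l]) => p pP ps i u u1.
have [ie|/ltW ie] := lerP e (opnorm (a i)).
  have [y yf /ltW] := fP i u u1; apply: le_trans.
  apply: nm_projB_le => //; apply: (ps (pr i y)).
  have := lP _ ie; elim: l {lP ps} => //= j l ih [->|/ih il];
    apply/List.in_or_app; [by left|by right].
apply: (@le_trans _ _ (nm (a i u - 0))); first by apply: nm_projB_le; rewrite ?c00.
rewrite subr0 (le_trans (nm_c0_le _ _))// (le_trans _ ie)// ler_piMr//.
by apply: opnorm_ge0; [exact: c0lin|exact: c0cont].
Qed.

End RankOne.

(** * Orthogonal complements of closed submodules *)

(** The part of the nearest point argument that uses no completeness, the form being only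
    semidefinite. Near-orthogonality is the discriminant of the distance inequality along a line in
    [M]; the Cauchy estimate is the parallelogram identity with the midpoint of [m n] and [m k]. *)
Lemma near_minimizer (R : realType) (V : lmodType R[i]) (b : V -> V -> R)
    (M : set V) (z : V) : psd_form b -> M 0 ->
  (forall (c : R[i]) x y, M x -> M y -> M (c *: x + y)) ->
  exists m : nat -> V, [/\ forall n, M (m n),
    forall n x, M x -> b x (z - m n) ^+ 2 <= n.+1%:R^-1 * b x x &
    forall n k, b (m n - m k) (m n - m k) <= 2 * n.+1%:R^-1 + 2 * k.+1%:R^-1].
Proof.
move=> bP M0 Ml; pose S := [set b (z - m) (z - m) | m in M].
have Slb : lbound S 0 by move=> _ [m _ <-]; exact: psd_ge0.
have Sinf : has_inf S by split; [exists (b (z - 0) (z - 0)), 0|exists 0].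
pose d := inf S.
have dle m : M m -> d <= b (z - m) (z - m).
  by move=> Mm; apply: ge_inf; [exists 0|exists m].
have mex n : exists m, M m /\ b (z - m) (z - m) < d + n.+1%:R^-1.
  have n0 : 0 < n.+1%:R^-1 :> R by rewrite invr_gt0.
  by have [_ [m Mm <-] mlt] := inf_adherent n0 Sinf; exists m.
have [m mP] := choice mex; exists m.
split=> [n|n x Mx|n k]; first by have [] := mP n.
  have [Mm mlt] := mP n.
  apply: discriminant_le => [|s]; first exact: psd_ge0.
  have := dle (- s%:C *: x + m n) (Ml _ _ _ Mx Mm).
  have -> : z - (- s%:C *: x + m n) = (z - m n) + s%:C *: x.
    by rewrite opprD scaleNr opprK addrA addrAC.
  move: (z - m n) mlt => w mlt.
  rewrite (psdD bP) !(psdDl bP) !(psdZ bP) !(psdZl bP) (psdC bP w x).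
  have -> : forall p q r : R, p + s * q + (s * q + s * (s * r)) =
    p + 2 * s * q + s ^+ 2 * r by move=> *; ring.
  by move: (n.+1%:R^-1) mlt => q mlt; lra.
have [Mn nlt] := mP n; have [Mk klt] := mP k.
have := psd_parallelogram bP (z - m n) (z - m k).
have -> : z - m n - (z - m k) = - (m n - m k).
  by rewrite opprB addrC opprB addrA subrK.
rewrite (psdN bP) (psdNl bP) opprK.
pose h : R[i] := (2^-1)%:C.
have M2 : M (h *: m n + h *: m k).
  by apply: (Ml) => //; rewrite -[h *: _]addr0; exact: Ml.
have -> : z - m n + (z - m k) = (2%:R)%:C *: (z - (h *: m n + h *: m k)).
  rewrite scalerBr scalerDr !scalerA -rmorphM/= divff ?pnatr_eq0// !scale1r.
  rewrite -[_%:C]/((2%:R)%:C) rmorph_nat scaler_nat mulr2n opprD !addrA.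
  by congr (_ + _); rewrite addrAC.
rewrite (psdZ bP) (psdZl bP); have := dle _ M2.
move: (n.+1%:R^-1) (k.+1%:R^-1) nlt klt => p q nlt klt; lra.
Qed.

Lemma sqr_le_eps (R : realFieldType) (a K : R) :
  (forall e, 0 < e -> a ^+ 2 <= K * e) -> a = 0.
Proof.
move=> aK; apply/eqP; rewrite -sqrf_eq0 eq_le sqr_ge0 andbT.
have [K0|K0] := lerP K 0.
  by rewrite (le_trans (aK 1 ltr01))// mulr1.
rewrite leNgt; apply/negP => a0.
have /aK : 0 < a ^+ 2 / (2 * K) by rewrite divr_gt0// mulr_gt0.
have -> : K * (a ^+ 2 / (2 * K)) = a ^+ 2 / 2 by field; rewrite gt_eqF.
lra.
Qed.

(* The norm is only equivalent to the one induced by the inner product, so that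
   the product of two Hilbert modules is one for the max norm. *)
Record hmod (R : realType) (I : Type) (H : I -> hilbertSpace R) := Hmod {
  hcar :> lmodType R[i];
  hact : hcar -> c0sum H -> hcar;
  hip : hcar -> hcar -> c0sum H;
  hnm : hcar -> R;
  hactPl : forall a c x y, hact (c *: x + y) a = c *: hact x a + hact y a;
  hactPr : forall x c a b, hact x (c *: a + b) = c *: hact x a + hact x b;
  hactA : forall x a b, hact (hact x a) b = hact x (c0sum_mul a b);
  hip_lin : forall x, linear (hip x);
  hip_act : forall x y a, hip x (hact y a) = c0sum_mul (hip x y) a;
  hip_adj : forall x y, c0sum_adjoint (hip x y) (hip y x);
  hip_ge0 : forall x, c0sum_ge0 (hip x x);
  hnm_ge0 : forall x, 0 <= hnm x;
  hnmD : forall x y, hnm (x + y) <= hnm x + hnm y;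
  hnmN : forall x, hnm (- x) = hnm x;
  hnm_complete : forall u : nat -> hcar,
    (forall e : R, 0 < e -> exists N, forall n k, (N <= n)%N -> (N <= k)%N ->
       hnm (u n - u k) < e) ->
    exists l, forall e : R, 0 < e ->
      exists N, forall n, (N <= n)%N -> hnm (u n - l) < e;
  hip_ub : exists2 C : R, 0 < C & forall x i (u : H i), nm u <= 1 ->
    qf (hip x x) u <= C * hnm x ^+ 2;
  hip_lb : forall x (c : R), 0 <= c ->
    (forall i (u : H i), nm u <= 1 -> qf (hip x x) u <= c) -> hnm x ^+ 2 <= c }.

Section Complement.
Context (R : realType) (I : Type) (H : I -> hilbertSpace R) (V : hmod H).
Implicit Types x y z : V.

(** Scalar semi-inner products, to which Hilbert space arguments apply; vanishing of all of them on
    a submodule gives orthogonality for [hip], see [phi_hperp]. *)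
Definition phi i (u : H i) x y : R := qf (hip x y) u.

Lemma hactB x y a : hact (x - y) a = hact x a - hact y a.
Proof.
have -> : x - y = -1 *: y + x by rewrite scaleN1r addrC.
by rewrite hactPl scaleN1r addrC.
Qed.

Lemma hact0 x : hact x 0 = 0.
Proof.
have := hactPr x 1 0 0; rewrite !scale1r addr0 => /eqP.
by rewrite -[X in X == _]addr0 (inj_eq (addrI _)) eq_sym => /eqP.
Qed.

Lemma hipD x y z : hip x (y + z) = hip x y + hip x z.
Proof. by have := hip_lin x 1 y z; rewrite !scale1r. Qed.

Lemma hip0 x : hip x 0 = 0.
Proof.
have := hipD x 0 0; rewrite addr0 => /eqP.
by rewrite -[X in X == _]addr0 (inj_eq (addrI _)) eq_sym => /eqP.
Qed.

Lemma hipZ c x y : hip x (c *: y) = c *: hip x y.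
Proof. by have := hip_lin x c y 0; rewrite addr0 hip0 addr0. Qed.

Lemma dot_hipC x y i (u v : H i) :
  hs_dot (H i) (hip x y i u) v = hs_dot (H i) u (hip y x i v).
Proof. exact: hip_adj. Qed.

Lemma dot_hip_actl x y a i (u v : H i) :
  hs_dot (H i) (hip (hact x a) y i u) v = hs_dot (H i) (hip x y i u) (a i v).
Proof. by rewrite !dot_hipC hip_act. Qed.

Lemma dot_hipZl c x y i (u v : H i) :
  hs_dot (H i) (hip (c *: x) y i u) v = (c^*)%C * hs_dot (H i) (hip x y i u) v.
Proof. by rewrite !dot_hipC hipZ c0scaleE dotZr. Qed.

Lemma psd_phi i (u : H i) : psd_form (phi u).
Proof.
split=> [x y z|c x y|x y|x]; rewrite /phi.
- by rewrite hipD qfD.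
- by rewrite hipZ qfZ.
- by rewrite /qf /rdot dot_hipC dotC ReJ.
- by have := hip_ge0 x u; rewrite lecE => /andP[].
Qed.

Record submodule (M : set V) : Prop := Submodule {
  sub0 : M 0;
  sub_lin : forall (c : R[i]) x y, M x -> M y -> M (c *: x + y);
  sub_act : forall x a, M x -> M (hact x a) }.

Definition hclosed (M : set V) := forall x,
  (forall e : R, 0 < e -> exists2 y, M y & hnm (x - y) < e) -> M x.

Definition hperp (M : set V) : set V := [set y | forall x, M x -> hip x y = 0].

Lemma subB M x y : submodule M -> M x -> M y -> M (x - y).
Proof.
move=> Ms Mx My; rewrite addrC -scaleN1r; exact: sub_lin.
Qed.

Lemma subZ M c x : submodule M -> M x -> M (c *: x).
Proof. by move=> Ms Mx; rewrite -[_ *: _]addr0; apply: sub_lin => //; exact: sub0. Qed.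

Lemma hperpD M x y : hperp M x -> hperp M y -> hperp M (x + y).
Proof. by move=> xP yP z Mz; rewrite hipD xP// yP// addr0. Qed.

Lemma hperpZ M c x : hperp M x -> hperp M (c *: x).
Proof. by move=> xP z Mz; rewrite hipZ xP// scaler0. Qed.

Lemma hperp_act M x a : hperp M x -> hperp M (hact x a).
Proof. by move=> xP z Mz; rewrite hip_act xP//; apply: c0sumP. Qed.

(** Testing on -i x, again an element of [M], turns the real part into the imaginary one. *)
Lemma phi_dot_eq0 M y i (u : H i) : submodule M ->
  (forall x, M x -> phi u x y = 0) ->
  forall x, M x -> hs_dot (H i) (hip x y i u) u = 0.
Proof.
move=> Ms y0 x Mx.
have re := y0 _ Mx; have := y0 _ (subZ (- 'i) Ms Mx).
move: re; rewrite /phi /qf /rdot dot_hipZl.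
have -> : ((- 'i)^*)%C = 'i :> R[i] by apply/eqP; rewrite eq_complex/= oppr0 opprK !eqxx.
rewrite mulrC ReiNIm => /= re /eqP; rewrite oppr_eq0 => /eqP im.
by apply/eqP; rewrite eq_complex/= re im !eqxx.
Qed.

Lemma phi_hperp M y : submodule M ->
  (forall i (u : H i) x, M x -> phi u x y = 0) -> hperp M y.
Proof.
move=> Ms y0 x Mx; apply: qf_eq0 => i u; first exact: y0.
by rewrite /qf c0scaleE /rdot dotZl (phi_dot_eq0 Ms (y0 i u))// mulr0.
Qed.

(** Continuity of [phi u x]. The constant may depend on [x] and [u], which stay fixed in the limit
    arguments. *)
Lemma phi_hnm x : exists K : forall i, H i -> R, forall i (u : H i),
  0 <= K i u /\ forall y, phi u x y ^+ 2 <= K i u * hnm y ^+ 2.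
Proof.
have [C C0 CP] := hip_ub V.
exists (fun i u => phi u x x * (C * nm u ^+ 2)) => i u; split=> [|y].
  by rewrite mulr_ge0 ?(psd_ge0 (psd_phi u))// mulr_ge0 ?sqr_ge0// ltW.
rewrite (le_trans (psd_CS (psd_phi u) x y))// -mulrA.
rewrite ler_wpM2l ?(psd_ge0 (psd_phi u))// mulrAC.
by apply: qf_bound => v; exact: CP.
Qed.

Lemma phi_act_actE e i (u : H i) x y :
  phi u (hact x e) (hact y e) = rdot (hip x y i (e i u)) (e i u).
Proof. by rewrite /phi /qf /rdot dot_hip_actl hip_act. Qed.

Lemma sqr_inv_succ_small (a : R) (b : nat -> R) :
  (forall n, b n ^+ 2 <= a * n.+1%:R^-1) ->
  forall e, 0 < e -> exists N, forall n, (N <= n)%N -> b n < e.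
Proof.
move=> ba e e0; have e2 : 0 < e ^+ 2 by rewrite exprn_gt0.
have a0 : 0 <= a by have := ba 0; rewrite invr1 mulr1; apply: le_trans; rewrite sqr_ge0.
exists (Num.truncn (a / e ^+ 2)) => n Nn.
have : a / e ^+ 2 < n.+1%:R.
  by apply: lt_le_trans (truncnS_gt _) _; rewrite ler_nat.
rewrite ltr_pdivrMr// mulrC -ltr_pdivrMr ?ltr0Sn// => h.
have := le_lt_trans (ba n) h.
have [b0|b0] := lerP (b n) 0; first by rewrite (le_lt_trans b0).
by rewrite ltr_pXn2r ?nnegrE// ltW.
Qed.

(* [c *: rank1_c0 w] is a minimal projection [e], and the vectors [hact z e] form
   a Hilbert space for the form [phi w], in which [hact x e] has a nearest point
   in [M]. *)
Lemma complement_rank1 (M : set V) i (w : H i) x :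
  submodule M -> hclosed M ->
  exists2 m, M m & hperp M (hact x (rank1_c0 w) - m).
Proof.
move=> Ms Mcl; have [w0|wN0] := eqVneq w 0.
  have -> : rank1_c0 w = 0.
    apply: c0sumP => j u; rewrite rank1_c0E c0zeroE w0.
    have [ij|ij] := pselect (i = j); last by rewrite single_neq// scaler0.
    by subst j; rewrite single_eq scaler0.
  by exists 0; [exact: sub0|rewrite hact0 subr0 => y _; rewrite hip0].
pose c := (nm w ^+ 2)^-1.
have w20 : 0 < nm w ^+ 2 by rewrite exprn_gt0// nm_gt0.
have c0 : 0 < c by rewrite invr_gt0.
(* The summand 0 gives [e] the shape expected by [hactPr]. *)
pose e : c0sum H := c%:C *: rank1_c0 w + 0.
have eE j u : e j u = (c%:C * hs_dot (H j) u (single w j)) *: single w j.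
  by rewrite /e c0addE c0scaleE rank1_c0E c0zeroE addr0 scalerA.
have ew : e i w = w.
  by rewrite eE single_eq dot_self -rmorphM/= mulVf ?scale1r// gt_eqF.
have ee : c0sum_mul e e = e.
  apply: c0sumP => j u; rewrite c0mulE !eE.
  have [ij|ij] := pselect (i = j); last by rewrite single_neq// !scaler0.
  subst j; rewrite single_eq dotZl dot_self; congr (_ *: _).
  by rewrite mulrCA -rmorphM/= mulVf ?mulr1// gt_eqF.
suff [m Mm mP] : exists2 m, M m & hperp M (hact x e - m).
  exists ((nm w ^+ 2)%:C *: m); first exact: subZ.
  have -> : hact x (rank1_c0 w) = (nm w ^+ 2)%:C *: hact x e.
    rewrite /e hactPr hact0 addr0 scalerA -rmorphM/= divff ?scale1r//.
    by rewrite gt_eqF.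
  by rewrite -scalerBr; exact: hperpZ.
have phie y z : phi w y (hact z e) = phi w y z.
  by rewrite /phi /qf hip_act c0mulE ew.
(* On vectors [hact y e] the norm is controlled by the scalar form. Thus a minimizing sequence,
   Cauchy for [phi w] only, becomes Cauchy in norm after acting by [e]. *)
have hnme y : hnm (hact y e) ^+ 2 <= c * phi w y y.
  have P0 : 0 <= c * phi w y y by rewrite mulr_ge0 ?(ltW c0)// (psd_ge0 (psd_phi w)).
  apply: hip_lb => // j u u1; rewrite -/(phi u _ _) phi_act_actE eE.
  have [ij|ij] := pselect (i = j); last first.
    by rewrite single_neq// scaler0 /rdot dot0r.
  subst j; rewrite single_eq c0Z /rdot dotZl dotZr mulrA -sqr_normc normrM exprMn.
  have [r [r0 rw <-]] : exists r : R, [/\ 0 <= r, r <= nm w & r%:C = `|hs_dot _ u w|].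
    exists (complex.Re `|hs_dot (H i) u w|); split; last exact: Re_norm.
      by rewrite -lecR Re_norm normr_ge0.
    by rewrite (le_trans (normr_dot _ _))// ler_piMl ?nm_ge0.
  have -> : `|c%:C| = c%:C by apply: ger0_norm; rewrite ler0c ltW.
  rewrite -!rmorphXn -rmorphM/= Re_RM -/(rdot _ _) -/(qf _ _) -/(phi _ _ _).
  rewrite ler_wpM2r ?(psd_ge0 (psd_phi w))// expr2 -mulrA ler_piMr ?(ltW c0)//.
  by rewrite mulrC ler_pdivrMr// mul1r ler_sqr ?nnegrE ?nm_ge0.
have [m [Mm mperp mC]] := near_minimizer x (psd_phi w) (sub0 Ms) (sub_lin Ms).
have [|l lP] := @hnm_complete _ _ _ V (fun n => hact (m n) e).
  have sq n k : hnm (hact (m n) e - hact (m k) e) ^+ 2 <=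
      c * (2 * n.+1%:R^-1 + 2 * k.+1%:R^-1).
    by rewrite -hactB (le_trans (hnme _))// ler_pM2l.
  move=> eps eps0; have eps2 : 0 < eps / 2 by rewrite divr_gt0.
  (* With the factor 4, the bound in [sq] is the mean of [b n ^+ 2] and [b k ^+ 2]. *)
  pose b n := Num.sqrt (c * (4 * n.+1%:R^-1)).
  have bE n : b n ^+ 2 = c * (4 * n.+1%:R^-1).
    by rewrite sqr_sqrtr// mulr_ge0 ?(ltW c0)// mulr_ge0// invr_ge0.
  have [|N bN] := @sqr_inv_succ_small (c * 4) b _ _ eps0.
    by move=> n; rewrite bE mulrA.
  exists N => n k Nn Nk.
  have b0 n' : 0 <= b n' by exact: sqrtr_ge0.
  suff : hnm (hact (m n) e - hact (m k) e) ^+ 2 < eps ^+ 2.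
    by rewrite ltr_sqr ?nnegrE ?hnm_ge0// ltW.
  apply: (le_lt_trans (sq n k)).
  have bsq n' : (N <= n')%N -> b n' ^+ 2 < eps ^+ 2.
    by move=> /bN; rewrite ltr_sqr ?nnegrE// ltW.
  have := bsq _ Nn; have := bsq _ Nk; rewrite !bE.
  move: (n.+1%:R^-1) (k.+1%:R^-1) => p q h1 h2.
  rewrite mulrDr; lra.
have Ml : M l.
  apply: Mcl => eps eps0; have [N lN] := lP _ eps0.
  exists (hact (m N) e); first exact: sub_act.
  by rewrite -hnmN opprB; exact: lN.
exists (hact l e); first exact: sub_act.
rewrite -hactB; set y := hact _ e.
have phiy z : M z -> phi w z y = 0.
  move=> Mz; rewrite /y phie; have [K KP] := phi_hnm z.
  have [K0 {}KP] := KP i w.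
  (* The value splits as A + B, where A is small by near-orthogonality and B by convergence; the
     constant comes from (A + B)^2 <= 2 A^2 + 2 B^2. *)
  apply: (@sqr_le_eps _ _ (2 * phi w z z + 2 * K i w)) => eps eps0.
  have zz : 0 <= phi w z z by exact: psd_ge0 (psd_phi w) z.
  pose d := Num.min eps 1.
  have d0 : 0 < d by rewrite lt_min eps0 ltr01.
  have [N1 lN1] := lP _ d0.
  pose N2 := Num.truncn eps^-1.
  pose n := maxn N1 N2.
  have ln : hnm (hact (m n) e - l) < d by apply: lN1; rewrite leq_maxl.
  have n2 : n.+1%:R^-1 < eps.
    rewrite -[ltRHS]invrK ltf_pV2 ?posrE ?invr_gt0//.
    apply: lt_le_trans (truncnS_gt _) _; rewrite ler_nat ltnS.
    exact: leq_maxr.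
  have -> : phi w z (x - l) = phi w z (x - m n) + phi w z (hact (m n) e - l).
    rewrite -(phie z (x - m n)) hactB -(psdD (psd_phi w)).
    rewrite [RHS]psdD//; last exact: psd_phi.
    by rewrite !(psdB (psd_phi w)) !phie; ring.
  have h1 := mperp n z Mz; have h2 := KP (hact (m n) e - l).
  have h3 : hnm (hact (m n) e - l) ^+ 2 <= eps.
    apply: (@le_trans _ _ (hnm (hact (m n) e - l))).
      rewrite expr2 ler_piMr ?hnm_ge0// (le_trans (ltW ln))//.
      by rewrite ge_min lexx orbT.
    by rewrite (le_trans (ltW ln))// ge_min lexx.
  have h4 : n.+1%:R^-1 * phi w z z <= eps * phi w z z by rewrite ler_wpM2r// ltW.
  have h5 : K i w * hnm (hact (m n) e - l) ^+ 2 <= K i w * eps by rewrite ler_wpM2l.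
  move: (phi w z (x - m n)) (phi w z (hact (m n) e - l)) h1 h2 => A B h1 h2.
  have : 0 <= (A - B) ^+ 2 by exact: sqr_ge0.
  move: (n.+1%:R^-1 * _) h4 h1 => q h4 h1.
  move: (K i w * _) h5 h2 => q' h5 h2.
  rewrite sqrrB sqrrD; lra.
move=> z Mz; pose p := hip z y i w.
have pw : hs_dot (H i) p w = 0 by exact: (phi_dot_eq0 Ms phiy).
have p0 : p = 0.
  (* As [p] is orthogonal to [w], this operator sends [w] to |w|^2 (p + w), whose product with [p]
     is |w|^2 |p|^2; stability of [M] under the action makes it vanish. *)
  have /phiy : M (hact z (rank1_c0 (p + w))) by exact: sub_act.
  rewrite /phi /qf /rdot dot_hip_actl -/p rank1_c0E single_eq dotZr !dotDr pw addr0.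
  rewrite [hs_dot _ w p]dotC pw conjc0 add0r !dot_self conjc_real Re_RM/=.
  move/eqP; rewrite mulf_eq0 gt_eqF//= sqrf_eq0 nm_eq0 => /eqP.
  by [].
(* Since [y] is fixed by [e], whose range is C w, it is enough that [hip z y] kills [w]. *)
have -> : hip z y = c0sum_mul (hip z y) e.
  by rewrite -hip_act /y hactA ee.
apply: c0sumP => j u; rewrite c0zeroE c0mulE eE c0Z.
have [ij|ij] := pselect (i = j); last by rewrite single_neq// c00 scaler0.
by subst j; rewrite single_eq -/p p0 scaler0.
Qed.

End Complement.

Section OrthogonalSum.
Context (R : realType) (I : Type) (H : I -> hilbertSpace R) (V : hmod H).
Implicit Types x y z : V.
Context (M : set V) (Ms : submodule M) (Mcl : hclosed M).

Definition orthogonal_sum : set V := [set x | exists2 m, M m & hperp M (x - m)].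

Lemma orthogonal_sum_lin (c : R[i]) x y :
  orthogonal_sum x -> orthogonal_sum y -> orthogonal_sum (c *: x + y).
Proof.
move=> [m Mm mP] [n Mn nP]; exists (c *: m + n); first exact: sub_lin.
rewrite opprD addrACA -scalerBr; apply: hperpD => //; exact: hperpZ.
Qed.

(** With T = <x, x> and v = (1 - e) u, the form of <x - x e, x - x e> at u equals <(1 - e) T v, v>,
    which is small once e almost fixes the image of the unit ball under T. The vector x e splits
    because e is obtained from rank-one elements by linear combinations. *)
Lemma orthogonal_sum_dense x (eps : R) : 0 < eps ->
  exists2 y, orthogonal_sum y & hnm (x - y) < eps.
Proof.
move=> eps0; pose d := eps ^+ 2 / 2.
have d0 : 0 < d by rewrite divr_gt0// exprn_gt0.
have [s sP] := compact_finite_rank_approx (hip x x) d0.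
pose D : set (c0sum H) := [set a | orthogonal_sum (hact x a)].
have [|c a b Da Db|i w|e [De eproj es]] := @finite_rank_projection _ _ H D _ _ _ s.
- rewrite /D/= hact0; exists 0; first exact: sub0.
  by rewrite subr0 => y _; rewrite hip0.
- by rewrite /D/= hactPr; exact: orthogonal_sum_lin.
- exact: complement_rank1.
exists (hact x e) => //.
rewrite -ltr_sqr ?nnegrE ?hnm_ge0 ?ltW//.
apply: (@le_lt_trans _ _ d); last by rewrite ltr_pdivrMr// ltr_pMr ?exprn_gt0// ltr1n.
apply: hip_lb => [|i u u1]; first exact: ltW.
pose v := u - e i u; pose T := hip x x.
have [ea ee] := eproj.
have -> : qf (hip (x - hact x e) (x - hact x e)) u = rdot (T i v - e i (T i v)) v.
  have E := psd_phi V u; rewrite -/(phi u _ _) (psdB E) !(psdBl E).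
  have P := psd_rdot (H i).
  have -> : rdot (T i v - e i (T i v)) v = rdot (T i v) v.
    rewrite (psdBl P) [X in _ - X](_ : _ = 0) ?subr0//.
    by rewrite /rdot ea [e i v]c0B ee subrr dot0r.
  rewrite phi_act_actE /phi /qf hip_act c0mulE {2}/rdot dot_hip_actl -/(rdot _ _).
  by rewrite /v c0B (psdB P) !(psdBl P) /T; ring.
rewrite (le_trans (rdot_CS _ _))//.
have v1 : nm v <= 1.
  have := @nm_projB_le _ _ _ e i u 0 eproj (c00 _ _); rewrite subr0.
  by move/le_trans; exact.
have := sP e eproj es i v v1; rewrite -/T.
have := nm_ge0 (T i v - e i (T i v)); have := nm_ge0 v.
move: (nm v) (nm (_ - _)) v1 => a b a1 a0 b0 bd.
by rewrite -[leRHS]mulr1 ler_pM.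
Qed.

(** Approximate x by split vectors [l n], with components [m n] in [M]. By Pythagoras in each form
    [phi u] the sequence [m] is Cauchy, up to the constant [C] comparing norm and forms, and its
    limit is the component of x. *)
Theorem orthogonal_complement x : exists2 m, M m & hperp M (x - m).
Proof.
pose r n : R := n.+1%:R^-1.
have r0 n : 0 < r n by rewrite invr_gt0.
have [l lP] := choice (fun n =>
  let: ex_intro2 y Sy xy := orthogonal_sum_dense x (r0 n) in
  ex_intro (fun y => orthogonal_sum y /\ hnm (x - y) < r n) y (conj Sy xy)).
have [m mP] := choice (fun n =>
  let: ex_intro2 m Mm mP := (lP n).1 in
  ex_intro (fun m => M m /\ hperp M (l n - m)) m (conj Mm mP)).
have rsmall (e : R) : 0 < e -> exists N, forall n, (N <= n)%N -> r n < e.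
  move=> e0; exists (Num.truncn e^-1) => n Nn.
  rewrite -[ltRHS]invrK ltf_pV2 ?posrE ?invr_gt0//.
  by apply: lt_le_trans (truncnS_gt _) _; rewrite ler_nat.
have [C C0 CP] := hip_ub V.
have hnm_m n k : hnm (m n - m k) ^+ 2 <= C * hnm (l n - l k) ^+ 2.
  apply: hip_lb => [|i u u1]; first by rewrite mulr_ge0 ?sqr_ge0// ltW.
  apply: le_trans (CP (l n - l k) i u u1).
  have -> : l n - l k = (m n - m k) + ((l n - m n) - (l k - m k)).
    by rewrite opprB addrACA subrKC addKr.
  have Mnk : M (m n - m k) by apply: subB => //; [exact: (mP n).1|exact: (mP k).1].
  have P : hperp M (l n - m n - (l k - m k)).
    apply: hperpD; first exact: (mP n).2.
    by rewrite -scaleN1r; apply: hperpZ; exact: (mP k).2.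
  have E := psd_phi V u.
  move: (m n - m k) (l n - m n - (l k - m k)) Mnk P => a b Ma Pb.
  rewrite -!/(phi u _ _) (psdD E) !(psdDl E) (psdC E b a) /phi Pb//.
  rewrite /qf c0zeroE /rdot dot0l addr0 add0r lerDl.
  exact: psd_ge0 E b.
have [|y yP] := @hnm_complete _ _ _ V m.
  move=> e e0.
  have d0 : 0 < e / (2 * (C + 1)) by rewrite divr_gt0// mulr_gt0// ltr_wpDl// ltW.
  have [N NP] := rsmall _ d0; exists N => n k /NP rn /NP rk.
  rewrite -ltr_sqr ?nnegrE ?hnm_ge0 ?(ltW e0)//.
  apply: (le_lt_trans (hnm_m n k)).
  have lnk : hnm (l n - l k) < e / (C + 1).
    have -> : l n - l k = - (x - l n) + (x - l k).
      by rewrite opprB addrA subrK.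
    apply: (le_lt_trans (hnmD _ _)); rewrite hnmN.
    have := (lP n).2; have := (lP k).2.
    have -> : e / (C + 1) = e / (2 * (C + 1)) + e / (2 * (C + 1)).
      by field; rewrite gt_eqF// ltr_wpDl// ltW.
    lra.
  have C1 : 0 < C + 1 by rewrite ltr_wpDl// ltW.
  move: lnk; rewrite ltr_pdivlMr// => lnk.
  have h0 := hnm_ge0 (l n - l k).
  apply: (@le_lt_trans _ _ ((hnm (l n - l k) * (C + 1)) ^+ 2)).
    move: (hnm _) h0 {lnk} => a a0.
    have -> : (a * (C + 1)) ^+ 2 = C * a ^+ 2 + (C ^+ 2 + C + 1) * a ^+ 2 by ring.
    by rewrite lerDl mulr_ge0 ?sqr_ge0// !addr_ge0 ?sqr_ge0// ltW.
  by rewrite ltr_sqr ?nnegrE ?(ltW e0)// mulr_ge0 ?(ltW C1).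
exists y.
  apply: Mcl => e e0; have [N NP] := yP _ e0; exists (m N); first exact: (mP N).1.
  by rewrite -hnmN opprB; exact: NP.
apply: phi_hperp => // i u z Mz.
have [K KP] := phi_hnm z; have [K0 {}KP] := KP i u.
apply: (@sqr_le_eps _ _ (K i u)) => e e0.
(* Two errors below [d] add up to at most both e and 1, so the square of the sum is at most e. *)
pose d := Num.min (e / 2) (2^-1).
have d0 : 0 < d by rewrite lt_min divr_gt0//= invr_gt0.
have [N1 N1P] := yP _ d0; have [N2 N2P] := rsmall _ d0.
pose n := maxn N1 N2.
have E := psd_phi V u.
(* The omitted part [l n - m n] is orthogonal to [M]; the two remaining differences are small. *)
have -> : phi u z (x - y) = phi u z ((x - l n) + (m n - y)).
  have -> : x - y = ((x - l n) + (m n - y)) + (l n - m n).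
    by rewrite -addrA (addrC (m n - y)) (addrA (l n - m n)) subrK addrA subrK.
  rewrite (psdD E _ (_ + _)) [X in _ + X](_ : _ = 0) ?addr0//.
  by rewrite /phi (mP n).2// /qf c0zeroE /rdot dot0l.
apply: (le_trans (KP _)); rewrite ler_wpM2l//.
have hn : hnm ((x - l n) + (m n - y)) <= d + d.
  rewrite (le_trans (hnmD _ _))// lerD// ltW//.
    by apply: lt_trans (lP n).2 _; apply: N2P; rewrite leq_maxr.
  by apply: N1P; rewrite leq_maxl.
have d1 : d + d <= e.
  by rewrite [leRHS]splitr lerD// ge_min lexx.
have d2 : d + d <= 1.
  by rewrite [leRHS]splitr lerD// ge_min div1r lexx orbT.
by rewrite -[leRHS]mulr1 expr2 ler_pM ?hnm_ge0//; lra.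
Qed.

End OrthogonalSum.

(** * Hilbert modules and their products *)

Section Product.
Context (R : realType) (I : Type) (H : I -> hilbertSpace R).

Program Definition hilbert_hmod (X : hilbertModule H) : hmod H :=
  @Hmod R I H X (fun x a => act x a) (@inner _ _ _ X) (@nm R X)
    _ _ _ _ _ _ _ _ _ _ _ _ _.
Next Obligation. by move=> X a c x y; exact: linearPl. Qed.
Next Obligation. by move=> X x c a b; exact: linearPr. Qed.
Next Obligation. by move=> X x a b; exact: actA. Qed.
Next Obligation. by move=> X x; exact: inner_linear. Qed.
Next Obligation. by move=> X x y a; exact: inner_act. Qed.
Next Obligation. by move=> X x y; exact: inner_adjoint. Qed.
Next Obligation. by move=> X x; exact: inner_ge0. Qed.
Next Obligation. by move=> X x; exact: nm_ge0. Qed.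
Next Obligation. by move=> X x y; exact: nmD. Qed.
Next Obligation. by move=> X x; exact: nmN. Qed.
Next Obligation. by move=> X u uC; exact: nm_complete uC. Qed.
Next Obligation.
move=> X /=; exists 1 => // x i u u1; rewrite mul1r.
rewrite (_ : nm x ^+ 2 = c0sum_norm (inner x x)); last first.
  by apply: (@complexI R); rewrite -inner_norm rmorphXn/= nmE.
apply: (le_trans (qf_le_opnorm _ _)).
have o0 : 0 <= opnorm (inner x x i) by apply: opnorm_ge0; [exact: c0lin|exact: c0cont].
rewrite (le_trans _ (opnorm_le_c0sum_norm _ i))// ler_piMr//.
by rewrite -[leRHS](expr1n _ 2) ler_sqr ?nnegrE ?nm_ge0.
Qed.
Next Obligation.
move=> X x c /= c0 xc.
rewrite (_ : nm x ^+ 2 = c0sum_norm (inner x x)); last first.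
  by apply: (@complexI R); rewrite -inner_norm rmorphXn/= nmE.
apply: c0sum_norm_le => // i; apply: opnorm_positive_le; last exact: xc.
by split; [exact: inner_ge0|exact: inner_adjoint].
Qed.

Context (V W : hmod H).
Implicit Types p q : V * W.

Let pip p q : c0sum H := hip p.1 q.1 + hip p.2 q.2.
Let pnm p : R := Num.max (hnm p.1) (hnm p.2).

Program Definition prod_hmod : hmod H :=
  @Hmod R I H (V * W)%type (fun p a => (hact p.1 a, hact p.2 a)) pip pnm
    _ _ _ _ _ _ _ _ _ _ _ _ _.
Next Obligation. by move=> a c [x x'] [y y']; congr pair; exact: hactPl. Qed.
Next Obligation. by move=> [x x'] c a b; congr pair; exact: hactPr. Qed.
Next Obligation. by move=> [x x'] a b; congr pair; exact: hactA. Qed.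
Next Obligation.
move=> p c q r; rewrite /pip !hip_lin scalerDr !addrA; congr (_ + _).
by rewrite addrAC.
Qed.
Next Obligation.
move=> p q a; rewrite /pip !hip_act; apply: c0sumP => i u.
by rewrite c0addE !c0mulE.
Qed.
Next Obligation.
by move=> p q i u v; rewrite /pip !c0addE dotDl dotDr !dot_hipC.
Qed.
Next Obligation.
by move=> p i u; rewrite /pip c0addE dotDl addr_ge0//; exact: hip_ge0.
Qed.
Next Obligation. by move=> p; rewrite le_max hnm_ge0. Qed.
Next Obligation.
move=> p q; rewrite /pnm/= ge_max; apply/andP; split.
  by rewrite (le_trans (hnmD _ _))// lerD// le_max lexx.
by rewrite (le_trans (hnmD _ _))// lerD// le_max lexx orbT.
Qed.
Next Obligation. by move=> p; rewrite /pnm/= !hnmN. Qed.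
Next Obligation.
move=> u uC.
have [|l lP] := @hnm_complete _ _ _ V (fun n => (u n).1).
  move=> e e0; have [N NP] := uC _ e0; exists N => n k Nn Nk.
  by have := NP n k Nn Nk; rewrite gt_max => /andP[].
have [|l' lP'] := @hnm_complete _ _ _ W (fun n => (u n).2).
  move=> e e0; have [N NP] := uC _ e0; exists N => n k Nn Nk.
  by have := NP n k Nn Nk; rewrite gt_max => /andP[].
exists (l, l') => e e0; have [N NP] := lP _ e0; have [N' NP'] := lP' _ e0.
exists (maxn N N') => n; rewrite geq_max => /andP[Nn Nn'].
by rewrite gt_max NP//= NP'.
Qed.
Next Obligation.
(* Under the max norm the upper constants add up, while the lower comparison keeps the constant
   1. *)
have [C C0 CP] := hip_ub V; have [D D0 DP] := hip_ub W.
exists (C + D) => [|p i u u1]; first by rewrite addr_gt0.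
rewrite /pip qfD mulrDl; apply: lerD.
  rewrite (le_trans (CP _ _ _ u1))// ler_pM2l// ler_sqr ?nnegrE ?hnm_ge0//.
    by rewrite le_max lexx.
  by rewrite le_max hnm_ge0.
rewrite (le_trans (DP _ _ _ u1))// ler_pM2l// ler_sqr ?nnegrE ?hnm_ge0//.
  by rewrite le_max lexx orbT.
by rewrite le_max hnm_ge0.
Qed.
Next Obligation.
move=> p c c0 pc.
have [le1 le2] : hnm p.1 ^+ 2 <= c /\ hnm p.2 ^+ 2 <= c.
  split; apply: hip_lb => // i u u1; apply: le_trans (pc i u u1);
    rewrite /pip qfD ?lerDl ?lerDr; exact: psd_ge0 (psd_phi _ u) _.
by rewrite /pnm maxEle; case: ifP.
Qed.

End Product.

Section InnerProduct.
Context (R : realType) (I : Type) (H : I -> hilbertSpace R) (V : hmod H).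
Implicit Types x y z : V.

Lemma c0_dotP (a b : c0sum H) : (forall i (u v : H i),
  hs_dot (H i) (a i u) v = hs_dot (H i) (b i u) v) -> a = b.
Proof.
move=> ab; apply: c0sumP => i u; apply/eqP; rewrite -subr_eq0; apply/eqP.
apply: dot_eq0; set w := _ - _.
by rewrite {1}/w dotDl ab -[- _]scaleN1r dotZl mulN1r subrr.
Qed.

Lemma hip_sym x y x' y' : hip x y = hip x' y' -> hip y x = hip y' x'.
Proof.
by move=> E; apply: c0_dotP => i u v; rewrite !dot_hipC E.
Qed.

Lemma hip_sym0 x y : hip x y = 0 -> hip y x = 0.
Proof.
rewrite -(hip0 x) => /hip_sym ->; apply: c0_dotP => i u v.
by rewrite dot_hipC hip0 c0zeroE dot0l dot0r.
Qed.

End InnerProduct.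

(** [K + 1] serves as a positive substitute for the square root of [K], as K <= (K + 1)^2. *)
Lemma sqr_lt_scale (R : realFieldType) (K a b e : R) : 0 <= K -> 0 <= b -> 0 < e ->
  a ^+ 2 <= K * b ^+ 2 -> b < e / (K + 1) -> a < e.
Proof.
move=> K0 b0 e0 abK; have K1 : 0 < K + 1 by rewrite ltr_wpDl.
rewrite ltr_pdivlMr// => bKe.
have [a0|a0] := lerP a 0; first exact: le_lt_trans e0.
rewrite -ltr_sqr ?nnegrE ?(ltW a0) ?(ltW e0)//.
apply: (le_lt_trans abK); apply: (@le_lt_trans _ _ ((b * (K + 1)) ^+ 2)).
  have -> : (b * (K + 1)) ^+ 2 = K * b ^+ 2 + (K ^+ 2 + K + 1) * b ^+ 2 by ring.
  by rewrite lerDl mulr_ge0 ?sqr_ge0// !addr_ge0 ?sqr_ge0.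
by rewrite ltr_sqr ?nnegrE ?(ltW e0)// mulr_ge0// ltW.
Qed.

(** * Closures and orthogonals of submodules *)

Section Perp.
Context (R : realType) (I : Type) (H : I -> hilbertSpace R) (V : hmod H).
Implicit Types (x y z : V) (D M : set V).

Lemma hipN x y : hip x (- y) = - hip x y.
Proof. by rewrite -scaleN1r hipZ scaleN1r. Qed.

Lemma hipB x y z : hip x (y - z) = hip x y - hip x z.
Proof. by rewrite hipD hipN. Qed.

Lemma hipDl x y z : hip (x + y) z = hip x z + hip y z.
Proof.
by apply: c0_dotP => i u v; rewrite dot_hipC hipD !c0addE dotDr dotDl !dot_hipC.
Qed.

Lemma hipNl x y : hip (- x) y = - hip x y.
Proof.
by apply/eqP; rewrite -addr_eq0 -hipDl addNr; apply/eqP/hip_sym0/hip0.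
Qed.

Lemma hnm_le0 x : hip x x = 0 -> hnm x = 0.
Proof.
move=> xx; apply/eqP; rewrite -sqrf_eq0 eq_le sqr_ge0 andbT.
by apply: hip_lb => // i u _; rewrite xx /qf c0zeroE /rdot dot0l.
Qed.

(** Bounds on the action and on scalar multiplication are not fields of [hmod]; up to a constant
    both follow from comparing [hnm] with the forms, which is enough to handle closures. *)
Lemma hnm_act_bound a : exists2 K : R, 0 <= K &
  forall x, hnm (hact x a) ^+ 2 <= K * hnm x ^+ 2.
Proof.
have [C C0 CP] := hip_ub V; pose N := c0sum_norm a ^+ 2.
have N0 : 0 <= N by exact: sqr_ge0.
exists (C * N) => [|x]; first by rewrite mulr_ge0// ltW.
apply: hip_lb => [|i u u1].
  exact: mulr_ge0 (mulr_ge0 (ltW C0) N0) (sqr_ge0 _).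
rewrite -/(phi u _ _) phi_act_actE -/(qf _ _).
rewrite (le_trans (qf_bound _ (CP x i)))// mulrAC.
rewrite ler_wpM2r ?sqr_ge0// ler_pM2l//.
have o0 : 0 <= opnorm (a i) by apply: opnorm_ge0; [exact: c0lin|exact: c0cont].
have aN : nm (a i u) <= c0sum_norm a.
  rewrite (le_trans (nm_c0_le _ _))// (le_trans _ (opnorm_le_c0sum_norm a i))//.
  by rewrite ler_piMr.
have aN0 := le_trans (nm_ge0 _) aN.
by rewrite ler_sqr ?nnegrE ?nm_ge0.
Qed.

Lemma hnm_scale_bound (c : R[i]) : exists2 K : R, 0 <= K &
  forall x, hnm (c *: x) ^+ 2 <= K * hnm x ^+ 2.
Proof.
have [C C0 CP] := hip_ub V; pose N := complex.Re (`|c| ^+ 2).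
have NE : N%:C = `|c| ^+ 2 by rewrite RRe_real// ger0_real// exprn_ge0.
have N0 : 0 <= N by rewrite -lecR NE exprn_ge0.
exists (C * N) => [|x]; first by rewrite mulr_ge0// ltW.
apply: hip_lb => [|i u u1].
  exact: mulr_ge0 (mulr_ge0 (ltW C0) N0) (sqr_ge0 _).
rewrite /qf hipZ c0scaleE /rdot dotZl dot_hipZl mulrA -sqr_normc -NE Re_RM.
rewrite -/(rdot _ _) -/(qf _ _) [C * N]mulrC -mulrA ler_wpM2l//; exact: CP.
Qed.

(** An [hmod] carries no topology; [closedP], [closed2P] and [denseP] relate this closure to the
    topological notions. *)
Definition hclosure D : set V :=
  [set x | forall e : R, 0 < e -> exists2 y, D y & hnm (x - y) < e].

Lemma hnm0 : hnm (0 : V) = 0.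
Proof. by apply: hnm_le0; rewrite hip0. Qed.

Lemma sub_hclosure D : D `<=` hclosure D.
Proof. by move=> x Dx e e0; exists x; rewrite // subrr hnm0. Qed.

Lemma hclosure_hclosed D : hclosed (hclosure D).
Proof.
move=> x xD e e0; have e20 : 0 < e / 2 by rewrite divr_gt0.
have [y yD xy] := xD _ e20; have [z Dz yz] := yD _ e20.
exists z => //; have -> : x - z = (x - y) + (y - z) by rewrite addrA subrK.
by rewrite (le_lt_trans (hnmD _ _))// [e]splitr ltrD.
Qed.

Lemma hclosure_submodule D : submodule D -> submodule (hclosure D).
Proof.
move=> Ds; split=> [|c x y xD yD e e0|x a xD e e0].
- by apply: sub_hclosure; exact: sub0.
- have [K K0 KP] := hnm_scale_bound c.
  have e20 : 0 < e / 2 by rewrite divr_gt0.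
  have [|x' Dx' xx'] := xD (e / 2 / (K + 1)).
    by rewrite divr_gt0// ltr_wpDl.
  have [y' Dy' yy'] := yD _ e20.
  exists (c *: x' + y'); first exact: sub_lin.
  have -> : c *: x + y - (c *: x' + y') = c *: (x - x') + (y - y').
    by rewrite scalerBr opprD addrACA.
  rewrite (le_lt_trans (hnmD _ _))// [e]splitr ltrD//.
  by apply: sqr_lt_scale (KP _) xx' => //; exact: hnm_ge0.
- have [K K0 KP] := hnm_act_bound a.
  have [|x' Dx' xx'] := xD (e / (K + 1)).
    by rewrite divr_gt0// ltr_wpDl.
  exists (hact x' a); first exact: sub_act.
  rewrite -hactB; apply: sqr_lt_scale (KP _) xx' => //; exact: hnm_ge0.
Qed.

Lemma hperp_submodule D : submodule (hperp D).
Proof.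
split=> [y _|c x y xD yD|x a xD]; first by rewrite hip0.
  by apply: hperpD => //; exact: hperpZ.
exact: hperp_act.
Qed.

Lemma hperp_hclosed D : submodule D -> hclosed (hperp D).
Proof.
move=> Ds y yD; apply: phi_hperp => // i u x Dx.
have [K /(_ i u)[K0 KP]] := phi_hnm x.
apply: (@sqr_le_eps _ _ (K i u)) => e e0.
pose d := Num.min e 1.
have d0 : 0 < d by rewrite lt_min e0 ltr01.
have [z zD yz] := yD _ d0.
have -> : phi u x y = phi u x (y - z).
  rewrite (psdB (psd_phi V u)) [X in _ - X](_ : _ = 0) ?subr0//.
  by rewrite /phi zD// /qf c0zeroE /rdot dot0l.
apply: le_trans (KP _) _; rewrite ler_wpM2l//.
have d1 : d <= 1 by rewrite ge_min lexx orbT.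
have de : d <= e by rewrite ge_min lexx.
rewrite -[leRHS]mulr1 expr2; apply: ler_pM; rewrite ?hnm_ge0//.
  exact: le_trans (ltW yz) de.
exact: le_trans (ltW yz) d1.
Qed.

Lemma sub_biperp D : D `<=` hperp (hperp D).
Proof. by move=> x Dx y yD; apply: hip_sym0; exact: yD. Qed.

Lemma hclosure_biperp D : submodule D -> hclosure D `<=` hperp (hperp D).
Proof.
move=> Ds x xD; apply: hperp_hclosed; first exact: hperp_submodule.
by move=> e /xD[y Dy xy]; exists y => //; exact: sub_biperp.
Qed.

Lemma biperp_decomposition D : submodule D ->
  forall x, exists2 m, hclosure D m & hperp D (x - m).
Proof.
move=> Ds x.
have [m Dm mP] := orthogonal_complement (hclosure_submodule Ds)
  (@hclosure_hclosed D) x.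
by exists m => // y Dy; apply: mP; exact: sub_hclosure.
Qed.

End Perp.

(** * Graphs and adjoints of closed operators *)

Section Adjoint.
Context (R : realType) (I : Type) (H : I -> hilbertSpace R).
Implicit Types X Y Z : hilbertModule H.

Local Notation hM := (@hilbert_hmod R I H).
Local Notation pM X Y := (prod_hmod (hM X) (hM Y)).

Definition perp X (D : set X) : set X := @hperp _ _ _ (hM X) D.
Definition submod X (D : set X) : Prop := @submodule _ _ _ (hM X) D.

Lemma innerD X (x y z : X) : inner x (y + z) = inner x y + inner x z.
Proof. exact: (@hipD _ _ _ (hM X)). Qed.
Lemma innerB X (x y z : X) : inner x (y - z) = inner x y - inner x z.
Proof. exact: (@hipB _ _ _ (hM X)). Qed.
Lemma innerN X (x y : X) : inner x (- y) = - inner x y.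
Proof. exact: (@hipN _ _ _ (hM X)). Qed.
Lemma inner0 X (x : X) : inner x 0 = 0.
Proof. exact: (@hip0 _ _ _ (hM X)). Qed.
Lemma innerZ X c (x y : X) : inner x (c *: y) = c *: inner x y.
Proof. exact: (@hipZ _ _ _ (hM X)). Qed.
Lemma innerDl X (x y z : X) : inner (x + y) z = inner x z + inner y z.
Proof. exact: (@hipDl _ _ _ (hM X)). Qed.
Lemma innerNl X (x y : X) : inner (- x) y = - inner x y.
Proof. exact: (@hipNl _ _ _ (hM X)). Qed.
Lemma inner0l X (x : X) : inner 0 x = 0.
Proof. exact: (@hip_sym0 _ _ _ (hM X) _ _ (inner0 x)). Qed.

Lemma inner_sym X Y (x y : X) (x' y' : Y) :
  inner x y = inner x' y' -> inner y x = inner y' x'.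
Proof.
by move=> E; apply: c0_dotP => i u v; rewrite (inner_adjoint y x) (inner_adjoint y' x') E.
Qed.

Lemma inner_sum_eq0 X Y (x : X) (y : Y) :
  inner x x + inner y y = 0 -> x = 0 /\ y = 0.
Proof.
move=> xy; have := @hnm_le0 _ _ _ (pM X Y) (x, y) xy; rewrite /= => /eqP.
have := nm_ge0 x; have := nm_ge0 y => y0 x0 xy0.
have : Num.max (nm x) (nm y) <= 0 by rewrite (eqP xy0).
rewrite ge_max => /andP[x1 y1].
by split; apply/eqP; rewrite -nm_eq0 eq_le ?x1 ?y1 ?x0 ?y0.
Qed.

Lemma closedP X (A : set X) : closed A <-> @hclosed _ _ _ (hM X) A.
Proof.
split=> [Ac x xA|Ac x /closure_nm xA]; last exact: Ac.
by apply: Ac; apply/closure_nm; exact: xA.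
Qed.

Lemma closed2P X Y (A : set (X * Y)) : closed A <-> @hclosed _ _ _ (pM X Y) A.
Proof.
split=> [Ac p pA|Ac p /closure_nm2 pA].
  apply: Ac; apply/closure_nm2 => e /pA[q Aq]; rewrite /= gt_max => /andP[].
  by exists q.
apply: Ac => e /pA[q Aq [q1 q2]]; exists q => //.
by rewrite /= gt_max; apply/andP.
Qed.

Lemma denseP X (A : set X) : dense A <-> forall x, @hclosure _ _ _ (hM X) A x.
Proof. exact: dense_nm. Qed.

Lemma perp_submod X (D : set X) : submod (perp D).
Proof. exact: hperp_submodule. Qed.

Lemma perp_self0 X (D : set X) x : D x -> perp D x -> x = 0.
Proof. by move=> Dx xD; apply: inner_eq0; exact: xD. Qed.

Lemma biperp_decomp X (D : set X) : submod D ->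
  forall x, exists m n, [/\ x = m + n, perp (perp D) m & perp D n].
Proof.
move=> Ds x; have [m mD mP] := biperp_decomposition Ds x.
exists m, (x - m); split=> //; first by rewrite subrKC.
exact: hclosure_biperp mD.
Qed.

Lemma biperp_closure X (D : set X) : submod D ->
  perp (perp D) `<=` @hclosure _ _ _ (hM X) D.
Proof.
move=> Ds x xD; have [m mD mP] := biperp_decomposition Ds x.
suff -> : x = m by [].
apply/eqP; rewrite -subr_eq0; apply/eqP; apply: (@perp_self0 X (perp D)); first exact: mP.
exact: (@subB _ _ _ (hM X) _ _ _ (perp_submod _) xD (hclosure_biperp Ds mD)).
Qed.

Lemma closed_biperp X (D : set X) : submod D -> closed D ->
  perp (perp D) `<=` D.
Proof. by move=> Ds /closedP Dc x /(biperp_closure Ds); exact: Dc. Qed.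

Lemma dense_perp0 X (D : set X) z : dense D -> perp D z -> z = 0.
Proof.
move=> /denseP Dd zD.
have [K KP] := @phi_hnm _ _ _ (hM X) z.
suff zz : inner z z = 0 by exact: inner_eq0.
have phi0 i (u : H i) : @phi _ _ _ (hM X) i u z z = 0.
  have [K0 {}KP] := KP i u.
  apply: (@sqr_le_eps _ _ (K i u)) => e e0.
  pose d := Num.min e 1.
  have d0 : 0 < d by rewrite lt_min e0 ltr01.
  have [x Dx zx] := Dd z _ d0.
  have -> : @phi _ _ _ (hM X) i u z z = @phi _ _ _ (hM X) i u z (z - x).
    rewrite (psdB (psd_phi (hM X) u)) (psdC (psd_phi (hM X) u) z x).
    by rewrite [X in _ - X](_ : _ = 0) ?subr0// /phi zD// /qf c0zeroE /rdot dot0l.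
  apply: le_trans (KP _) _; rewrite ler_wpM2l//.
  have d1 : d <= 1 by rewrite ge_min lexx orbT.
  have de : d <= e by rewrite ge_min lexx.
  rewrite -[leRHS]mulr1 expr2; apply: ler_pM; rewrite ?hnm_ge0//.
    exact: le_trans (ltW zx) de.
  exact: le_trans (ltW zx) d1.
have z0 : nm z ^+ 2 <= 0.
  by apply: (@hip_lb _ _ _ (hM X) z 0) => // i u _; rewrite [qf _ _]phi0.
suff -> : z = 0 by rewrite inner0.
by apply/eqP; rewrite -nm_eq0 -sqrf_eq0 eq_le z0 sqr_ge0.
Qed.

(** Rests on complementation: the biorthogonal of [D], here everything, lies in its closure. *)
Lemma perp0_dense X (D : set X) : submod D -> (forall z, perp D z -> z = 0) ->
  dense D.
Proof.
move=> Ds D0; apply/denseP => x; apply: (biperp_closure Ds).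
by move=> z /D0 ->; exact: inner0l.
Qed.

Section Operator.
Context (X Y : hilbertModule H) (t : set (X * Y)) (tO : operator t).

Lemma opB x y x' y' : t (x, y) -> t (x', y') -> t (x - x', y - y').
Proof.
move=> xy xy'; have := op_linear tO (-1) xy' xy.
by rewrite !scaleN1r addrC [- y' + _]addrC.
Qed.

Lemma opD x y x' y' : t (x, y) -> t (x', y') -> t (x + x', y + y').
Proof. by move=> xy xy'; have := op_linear tO 1 xy xy'; rewrite !scale1r. Qed.

Lemma opN x y : t (x, y) -> t (- x, - y).
Proof. by move=> xy; have := opB (op0 tO) xy; rewrite !sub0r. Qed.

Lemma op_submod : @submodule _ _ _ (pM X Y) t.
Proof.
split; first exact: op0.
  by move=> c [x y] [x' y']; exact: op_linear.
by move=> [x y] a; exact: op_act.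
Qed.

Definition kernel : set X := [set x | t (x, 0)].

Lemma kernel_submod : submod kernel.
Proof.
split; rewrite /kernel/=; first exact: op0.
  by move=> c x y x0 y0; have := op_linear tO c x0 y0; rewrite scaler0 addr0.
move=> x a x0; have := op_act tO a x0.
by rewrite (_ : act (0 : Y) a = 0)//; exact: linear0l.
Qed.

Lemma ran_submod : submod (ran t).
Proof.
split; first by exists (0, 0) => //; exact: op0.
  move=> c _ _ [[x y] xy <-] [[x' y'] xy' <-].
  by exists (c *: x + x', c *: y + y') => //; exact: op_linear.
by move=> _ a [[x y] xy <-]; exists (act x a, act y a) => //; exact: op_act.
Qed.

Lemma dom_submod : submod (dom t).
Proof.
split; first by exists (0, 0) => //; exact: op0.
  move=> c _ _ [[x y] xy <-] [[x' y'] xy' <-].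
  by exists (c *: x + x', c *: y + y') => //; exact: op_linear.
by move=> _ a [[x y] xy <-]; exists (act x a, act y a) => //; exact: op_act.
Qed.

Lemma kernel_adjE : (fun y => adj t (y, 0)) = perp (ran t).
Proof.
apply/seteqP; split=> y yt.
  by move=> _ [[x tx] xtx <-]; rewrite [LHS](yt x tx xtx) inner0.
by move=> x tx xtx /=; rewrite inner0; apply: yt; exists (x, tx).
Qed.

Lemma adj_kernelP y : adj t (y, 0) <-> perp (ran t) y.
Proof. by rewrite -kernel_adjE. Qed.

Lemma adj_closed : closed (adj t).
Proof.
(* The adjoint is the orthogonal of the graph rotated by (x, y) |-> (y, -x). *)
pose rot : set (Y * X) := [set q | t (- q.2, q.1)].
have rots : @submodule _ _ _ (pM Y X) rot.
  split; rewrite /rot/=.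
  - by rewrite oppr0; exact: op0.
  - move=> c [x y] [x' y'] /= xy xy'; rewrite opprD -scalerN; exact: op_linear.
  - move=> [x y] a /= xy; rewrite (_ : - act y a = act (- y) a); first exact: op_act.
    by apply/esym; exact: linearNl.
have -> : adj t = @hperp _ _ _ (pM Y X) rot.
  apply/seteqP; split=> [[y z] yz [tx x] /= xtx|[y z] yz x tx xtx].
    by have := yz _ _ xtx; rewrite /= innerNl => ->; rewrite addNr.
  have := yz (tx, - x); rewrite /rot/= opprK => /(_ xtx) /=.
  by rewrite innerNl => /eqP; rewrite subr_eq0 => /eqP.
by apply/closed2P; exact: hperp_hclosed.
Qed.

Lemma adj_operator : densely_defined t -> operator (adj t).
Proof.
move=> td; split.
- move=> y z z' yz yz'; apply/eqP; rewrite -subr_eq0; apply/eqP.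
  apply: (dense_perp0 td) => _ [[x tx] xtx <-] /=.
  have := yz _ _ xtx; rewrite (yz' _ _ xtx)/= => E.
  by rewrite [LHS]innerB E subrr.
- by move=> x tx _ /=; rewrite !inner0.
- move=> c y z y' z' yz yz' x tx xtx /=.
  by rewrite !innerD !innerZ (yz _ _ xtx) (yz' _ _ xtx).
- by move=> y z a yz x tx xtx /=; rewrite !inner_act (yz _ _ xtx).
Qed.

Lemma sub_adj_adj : t `<=` adj (adj t).
Proof. by move=> [x tx] xtx y z yz /=; apply: inner_sym; apply/esym; exact: yz. Qed.

End Operator.

Section ClosedOperator.
Context (X Y : hilbertModule H) (t : set (X * Y)).
Context (tO : operator t) (tC : closed t).

Lemma graph_decomp x y : exists u v, t (u, v) /\ adj t (y - v, u - x).
Proof.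
have [[u v] tuv P] := orthogonal_complement (op_submod tO) ((closed2P _).1 tC) (x, y).
exists u, v; split => // x' tx' xtx' /=.
have := P (x', tx') xtx'; rewrite /= -!/(inner _ _) => /eqP.
rewrite addrC addr_eq0 => /eqP ->.
by rewrite -innerN opprB.
Qed.

Lemma adj_adj : adj (adj t) = t.
Proof.
apply/seteqP; split; last exact: sub_adj_adj.
move=> [x y] xy; have [u [v [uv P]]] := graph_decomp x y.
(* Both (x, y) and (u, v) are paired with the element (y - v, u - x) of [adj t]; subtracting shows
   that the squares of the two differences add up to 0. *)
have h1 := xy _ _ P; have h2 := sub_adj_adj uv P.
have /inner_sum_eq0[/eqP ux /eqP yv] : inner (u - x) (u - x) + inner (y - v) (y - v) = 0.
  move: h1 h2; rewrite /= !innerB => -> ->.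
  by rewrite -innerB -innerB -[y - v]opprB innerN subrr.
by move: ux yv; rewrite !subr_eq0 => /eqP <- /eqP ->.
Qed.

Context (tD : densely_defined t).

Lemma adj_dense : densely_defined (adj t).
Proof.
have aO := adj_operator tD.
apply: perp0_dense => [|z zP]; first exact: dom_submod.
(* A vector orthogonal to the domain of [adj t] is a value of t^** = t at 0. *)
have : t (0, z).
  rewrite -adj_adj => y w yw /=; rewrite inner0; apply/esym/zP.
  by exists (y, w).
by move=> tz; apply: (op_fun tO tz); exact: op0.
Qed.

Lemma one_adj_comp_surj x : exists2 p, opcomp (adj t) t p & p.1 + p.2 = x.
Proof.
(* Decomposing (x, 0) gives v = t u and t^* v = x - u. *)
have [u [v [uv]]] := graph_decomp x 0; rewrite sub0r => P.
exists (u, x - u); last by rewrite /= subrKC.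
exists v => //.
by have := opN (adj_operator tD) P; rewrite opprK opprB.
Qed.

End ClosedOperator.
End Adjoint.

(** * Moore-Penrose inverses *)

Section MoorePenrose.
Context (R : realType) (I : Type) (H : I -> hilbertSpace R).
Implicit Types X Y Z : hilbertModule H.

Record cdd X Y (t : set (X * Y)) : Prop := Cdd {
  cdd_op : operator t;
  cdd_dense : densely_defined t;
  cdd_closed : closed t }.

Lemma cdd_adj X Y (t : set (X * Y)) : cdd t -> cdd (adj t).
Proof.
move=> [tO tD tC]; split; [exact: adj_operator|exact: adj_dense|].
exact: adj_closed.
Qed.

Lemma cdd_regular X Y (t : set (X * Y)) : cdd t -> regular t.
Proof.
move=> tP; have [tO tD tC] := tP; split => //; first exact: adj_dense.
by move=> O [x Ox] _; exists x; split=> //; exact: one_adj_comp_surj.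
Qed.

Lemma opcomp_operator X Y Z (s : set (Y * Z)) (t : set (X * Y)) :
  operator s -> operator t -> operator (opcomp s t).
Proof.
move=> sO tO; split.
- move=> x z z' [y xy yz] [y' xy' yz'].
  have E := op_fun tO xy xy'; simpl in *; subst y'; exact: (op_fun sO yz yz').
- by exists 0; exact: op0.
- move=> c x z x' z' [y xy yz] [y' xy' yz'].
  by exists (c *: y + y'); exact: op_linear.
- by move=> x z a [y xy yz]; exists (act y a); exact: op_act.
Qed.

Lemma kernel_perp_ran X Y (t : set (X * Y)) : cdd t ->
  forall x, t (x, 0) <-> perp (ran (adj t)) x.
Proof.
move=> tP x; rewrite -{1}(adj_adj (cdd_op tP) (cdd_closed tP)).
exact: adj_kernelP.
Qed.

Lemma adj_comp_kernel X Y (t : set (X * Y)) x : operator t ->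
  opcomp (adj t) t (x, 0) -> t (x, 0).
Proof.
move=> tO [y xy y0]; have := y0 _ _ xy; rewrite /= inner0 => /inner_eq0 E.
by rewrite -{1}E.
Qed.

Lemma opcomp_kernel X Y Z (s : set (Y * Z)) (t : set (X * Y)) x : operator s ->
  t (x, 0) -> opcomp s t (x, 0).
Proof. by move=> sO tx; exists 0 => //; exact: op0. Qed.

Lemma adj_comp_sym X Y (t : set (X * Y)) :
  opcomp (adj t) t `<=` adj (opcomp (adj t) t).
Proof.
move=> [x z] [y xy yz] x' z' [y' xy' yz'] /=.
by rewrite -(yz _ _ xy')/=; apply: inner_sym; rewrite -(yz' _ _ xy).
Qed.

(** If z = u + t^* t u is orthogonal to the domain, then 0 = <u, z> = <u, u> + <t u, t u>. *)
Lemma adj_comp_dense X Y (t : set (X * Y)) : cdd t ->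
  densely_defined (opcomp (adj t) t).
Proof.
move=> tP; have [tO tD tC] := tP.
have ttO : operator (opcomp (adj t) t).
  by apply: opcomp_operator => //; exact: adj_operator.
apply: perp0_dense; first exact: dom_submod.
move=> z zP; have [[u w] /= uw uwz] := one_adj_comp_surj tO tC tD z.
have : inner u z = 0 by apply: zP; exists (u, w).
rewrite -uwz innerD; case: uw => v uv vw.
rewrite -(vw _ _ uv)/= => /inner_sum_eq0[u0 v0]; subst u v.
have w0 : w = 0 := op_fun (adj_operator tD) vw (op0 (adj_operator tD)).
by rewrite w0 addr0.
Qed.

(** A symmetric T with 1 + T onto is self-adjoint: if T^* y = z and (1 + T) u = y + z, then y - u is
    killed by the adjoint of 1 + T, hence orthogonal to the range of 1 + T, which is everything. *)
Lemma adj_comp_adj X Y (t : set (X * Y)) : cdd t ->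
  adj (opcomp (adj t) t) = opcomp (adj t) t.
Proof.
move=> tP; have [tO tD tC] := tP.
apply/seteqP; split; last exact: adj_comp_sym.
move=> [y z] yz; have [[u w] /= uw uwyz] := one_adj_comp_surj tO tC tD (y + z).
suff E : y - u = 0.
  move: uwyz; rewrite -[y](subrK u) E add0r => /addrI <-.
  exact: uw.
have [[p q] /= pq pqE] := one_adj_comp_surj tO tC tD (y - u).
apply: inner_eq0; rewrite -{1}pqE innerDl.
have h1 := yz _ _ pq; have h2 := adj_comp_sym uw pq.
rewrite /= in h1 h2.
rewrite !innerB h1 h2.
have zw : z - w = u - y.
  by apply/eqP; rewrite subr_eq addrAC uwyz addrC addKr.
by rewrite -!innerB -innerD zw -[u - y]opprB subrr inner0.
Qed.

Lemma cdd_adj_comp X Y (t : set (X * Y)) : cdd t -> cdd (opcomp (adj t) t).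
Proof.
move=> tP; split.
- by apply: opcomp_operator; [exact: adj_operator (cdd_dense tP)|exact: cdd_op].
- exact: adj_comp_dense.
- by rewrite -(adj_comp_adj tP); apply: adj_closed; apply: opcomp_operator;
    [exact: adj_operator (cdd_dense tP)|exact: cdd_op].
Qed.

(** Orthogonality to [kernel t] encodes the closure of Ran t^*, and orthogonality to [ran t] encodes
    Ker t^*. *)
Definition mp_graph X Y (t : set (X * Y)) : set (Y * X) :=
  [set yx | perp (kernel t) yx.2 /\
            exists2 v, t (yx.2, v) & perp (ran t) (yx.1 - v)].

Lemma perp_inner X (D : set X) x y : perp D y -> D x -> inner x y = 0.
Proof. by move=> yP; exact: yP. Qed.

Lemma perp_innerl X (D : set X) x y : perp D y -> D x -> inner y x = 0.
Proof.
move=> yP Dx; rewrite -(inner0l x); apply: inner_sym.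
by rewrite inner0; exact: yP.
Qed.

Lemma perpD X (D : set X) x y : perp D x -> perp D y -> perp D (x + y).
Proof. exact: hperpD. Qed.

Lemma perpN X (D : set X) x : perp D x -> perp D (- x).
Proof. by move=> xP; rewrite -scaleN1r; exact: hperpZ. Qed.

Lemma perpB X (D : set X) x y : perp D x -> perp D y -> perp D (x - y).
Proof. by move=> xP yP; apply: perpD => //; exact: perpN. Qed.

Lemma perp0 X (D : set X) : perp D 0.
Proof. by move=> x _; exact: inner0. Qed.

Lemma perp_kernel_inj X Y (t : set (X * Y)) x x' y : operator t ->
  t (x, y) -> t (x', y) -> perp (kernel t) x -> perp (kernel t) x' -> x = x'.
Proof.
move=> tO xy x'y xP x'P; apply/eqP; rewrite -subr_eq0; apply/eqP.
apply: (@perp_self0 _ _ _ _ (kernel t)); last exact: perpB.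
by rewrite /kernel/= -(subrr y); exact: opB.
Qed.

Lemma kernel_decomp X Y (t : set (X * Y)) : operator t -> closed t ->
  forall x, exists k x', [/\ x = k + x', t (k, 0) & perp (kernel t) x'].
Proof.
move=> tO tC x; have [k [x' [xE kP x'P]]] := biperp_decomp (kernel_submod tO) x.
exists k, x'; split => //.
apply: (@closed_biperp _ _ _ _ (kernel t)) kP; first exact: kernel_submod.
apply/closedP => z zP; rewrite /kernel/=.
have /closed2P := tC; apply => e e0; have [y y0 zy] := zP e e0; exists (y, 0) => //.
by rewrite /= gt_max zy/= subr0 /nm normr0.
Qed.

Lemma mp_graph_operator X Y (t : set (X * Y)) : operator t ->
  operator (mp_graph t).
Proof.
move=> tO; split.
- move=> y x x' [/= xP [v xv yv]] [/= x'P [v' x'v' yv']].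
  have vv' : v = v'.
    apply/eqP; rewrite -subr_eq0; apply/eqP/(@perp_self0 _ _ _ _ (ran t)).
      by exists (x - x', v - v') => //; exact: opB.
    have -> : v - v' = (y - v') - (y - v) by rewrite opprB [RHS]addrC addrA subrK.
    exact: perpB.
  by subst v'; exact: perp_kernel_inj xv x'v' xP x'P.
- split; first exact: perp0.
  by exists 0; [exact: op0|rewrite subr0; exact: perp0].
- move=> c y x y' x' [/= xP [v xv yv]] [/= x'P [v' x'v' yv']]; split=> /=.
    by apply: perpD => //; exact: hperpZ.
  exists (c *: v + v'); first exact: op_linear.
  rewrite opprD addrACA -scalerBr; apply: perpD => //; exact: hperpZ.
- move=> y x a [/= xP [v xv yv]]; split=> /=; first exact: hperp_act.
  exists (act v a); first exact: op_act.
  by rewrite -(@hactB _ _ _ (hilbert_hmod Y)); exact: hperp_act.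
Qed.

(** Subtracting the kernel component of [x] leaves the canonical preimage of [v]. *)
Lemma mp_graph_ran X Y (t : set (X * Y)) x v : operator t -> closed t ->
  t (x, v) -> exists2 x', mp_graph t (v, x') & t (x', v).
Proof.
move=> tO tC xv; have [k [x' [xE k0 x'P]]] := kernel_decomp tO tC x.
have x'v : t (x', v).
  by have := opB tO xv k0; rewrite subr0 xE addrC addKr.
exists x' => //; split => //; exists v => //; rewrite subrr; exact: perp0.
Qed.

Lemma mp_graph_kernel X Y (t : set (X * Y)) n : operator t ->
  perp (ran t) n -> mp_graph t (n, 0).
Proof.
move=> tO nP; split; first exact: perp0.
by exists 0; [exact: op0|rewrite subr0].
Qed.

(** The domain contains both Ran t and its orthogonal, so a vector orthogonal to the domain is
    orthogonal to itself. *)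
Lemma mp_graph_dense X Y (t : set (X * Y)) : operator t -> closed t ->
  densely_defined (mp_graph t).
Proof.
move=> tO tC; have sO := mp_graph_operator tO.
apply: perp0_dense => [|z zP]; first exact: dom_submod.
have zn : perp (ran t) z.
  move=> _ [[x v] xv <-] /=; have [x' vx' _] := mp_graph_ran tO tC xv.
  by apply: zP; exists (v, x').
apply: inner_eq0; apply: zP.
by exists (z, 0) => //; exact: mp_graph_kernel.
Qed.

(* The Moore-Penrose graph of [t] is closed because it is the adjoint of that
   of [adj t]. *)
Lemma mp_graph_adj X Y (t : set (X * Y)) : cdd t ->
  adj (mp_graph (adj t)) `<=` mp_graph t.
Proof.
move=> tP; have [tO tD tC] := tP; have [aO aD aC] := cdd_adj tP.
move=> [y x] yx.
split=> /=.
  move=> k k0.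
  have /yx/= : mp_graph (adj t) (k, 0).
    by apply: mp_graph_kernel => //; apply/(kernel_perp_ran tP).
  by rewrite inner0l => <-.
have [v [n [yE vP nP]]] := biperp_decomp (ran_submod tO) y.
exists v; last by rewrite yE addrC addKr.
(* That t x = v is checked through t = t^**, by testing on the graph of t^*. *)
rewrite -(adj_adj tO tC) => w z wz /=.
have [k [w' [wE k0 w'P]]] := kernel_decomp aO aC w.
have w'z : adj t (w', z).
  by have := opB aO wz k0; rewrite subr0 wE addrC addKr.
have /yx/= <- : mp_graph (adj t) (z, w').
  by split => //; exists z => //=; rewrite subrr; exact: perp0.
rewrite wE innerDl (perp_inner vP) ?add0r; last exact/adj_kernelP.
rewrite yE innerD [X in _ + X](_ : _ = 0) ?addr0//.
by apply: (perp_innerl w'P); exact/adj_kernelP.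
Qed.

Lemma mp_graph_adj_sub X Y (t : set (X * Y)) : cdd t ->
  mp_graph t `<=` adj (mp_graph (adj t)).
Proof.
move=> tP; have [tO tD tC] := tP.
move=> [y x] [/= xP [v xv yv]] x' y' [/= y'P [u y'u x'u]].
have -> : inner y' y = inner y' v.
  rewrite -{1}(subrK v y) innerD [X in X + _](_ : _ = 0) ?add0r//.
  by apply: (perp_innerl y'P); exact/adj_kernelP.
rewrite /= (inner_sym (y'u _ _ xv : inner v y' = inner x u)).
rewrite -[in RHS](subrK u x') innerDl [X in _ = X + _](_ : _ = 0) ?add0r//.
by apply: (perp_inner xP); apply/(kernel_perp_ran tP).
Qed.

Lemma cdd_mp_graph X Y (t : set (X * Y)) : cdd t -> cdd (mp_graph t).
Proof.
move=> tP; have [tO tD tC] := tP; split.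
- exact: mp_graph_operator.
- exact: mp_graph_dense.
- have -> : mp_graph t = adj (mp_graph (adj t)).
    by apply/seteqP; split; [exact: mp_graph_adj_sub|exact: mp_graph_adj].
  apply: adj_closed; apply: mp_graph_operator; exact: cdd_op (cdd_adj tP).
Qed.

End MoorePenrose.

Section MoorePenroseInverse.
Context (R : realType) (I : Type) (H : I -> hilbertSpace R).
Implicit Types X Y Z : hilbertModule H.

(* A restriction of the projection onto the closure of [D], with a dense domain. *)
Definition partial_proj X (D : set X) : set (X * X) :=
  [set p | D p.2 /\ perp D (p.1 - p.2)].

Lemma partial_proj_adj X (D : set X) : submod D ->
  adj (partial_proj D) = closure (partial_proj D).
Proof.
move=> Ds; have D0 : D 0 by exact: (sub0 Ds).
(* The adjoint is the full projection onto the biorthogonal of [D]. *)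
have adjE : adj (partial_proj D) =
    [set p | perp (perp D) p.2 /\ perp D (p.1 - p.2)].
  apply/seteqP; split=> [[y z] yz|[y z] [/= zP yzP] y' v [/= Dv vP]].
    split=> [n nP|v Dv].
      have /yz/= : partial_proj D (n, 0) by split; rewrite //= subr0.
      by rewrite inner0l => <-.
    have /yz/= E : partial_proj D (v, v) by split; rewrite //= subrr; exact: perp0.
    by rewrite [LHS]innerB E subrr.
  rewrite -[y in LHS](subrK z) innerD [X in X + _](_ : _ = 0) ?add0r; last first.
    exact: (perp_inner yzP).
  rewrite -[y' in RHS](subrK v) innerDl [X in _ = X + _](_ : _ = 0) ?add0r//.
  exact: (perp_inner zP).
apply/seteqP; split; last first.
  have sym : partial_proj D `<=` adj (partial_proj D).
    move=> [y z] [/= Dz yzP]; rewrite adjE; split=> //=.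
    exact: (@sub_biperp _ _ _ (hilbert_hmod X)).
  apply: subset_trans (closureS sym) _.
  have pO : operator (partial_proj D).
    split.
    - move=> x y y' [/= Dy xy] [/= Dy' xy']; apply/eqP; rewrite -subr_eq0; apply/eqP.
      apply: (@perp_self0 _ _ _ _ D).
        exact: (@subB _ _ _ (hilbert_hmod X) _ _ _ Ds Dy Dy').
      have -> : y - y' = (x - y') - (x - y) by rewrite opprB [RHS]addrC addrA subrK.
      exact: perpB.
    - by split => //=; rewrite subrr; exact: perp0.
    - move=> c x y x' y' [/= Dy xy] [/= Dy' xy']; split=> /=.
        exact: (sub_lin Ds).
      rewrite opprD addrACA -scalerBr; apply: perpD => //; exact: hperpZ.
    - move=> x y a [/= Dy xy]; split=> /=; first exact: (sub_act Ds).
      by rewrite -(@hactB _ _ _ (hilbert_hmod X)); exact: hperp_act.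
  exact: (adj_closed pO).
rewrite adjE => -[y z] [/= zP yzP]; apply/closure_nm2 => e e0.
have [v Dv zv] := biperp_closure Ds zP e0.
(* The orthogonal part y - z is kept, and only z is approximated inside [D]. *)
exists (y - z + v, v) => /=; first by split; rewrite //= addrK.
have -> : y - (y - z + v) = z - v by rewrite opprD opprB addrA [y + _]addrC subrK.
by [].
Qed.

Lemma mp_graphP X Y (t : set (X * Y)) y x v : operator t ->
  mp_graph t (y, x) -> t (x, v) -> perp (ran t) (y - v).
Proof.
move=> tO [/= _ [v' xv' yv']] xv.
by rewrite (op_fun tO xv xv').
Qed.

Lemma comp_mp_graph X Y (t : set (X * Y)) : operator t -> closed t ->
  opcomp t (mp_graph t) = partial_proj (ran t).
Proof.
move=> tO tC; apply/seteqP; split=> [[y v] [x /= yx xv]|[y v] [/= [[x v'] xv /= E] yv]].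
  by split=> /=; [exists (x, v)|exact: mp_graphP yx xv].
subst v'; have [x' [/= x'P _] x'v] := mp_graph_ran tO tC xv.
by exists x' => //; split => //; exists v.
Qed.

Lemma mp_graph_comp X Y (t : set (X * Y)) : cdd t ->
  opcomp (mp_graph t) t = partial_proj (ran (mp_graph t)).
Proof.
move=> tP; have [tO tD tC] := tP.
have sO := mp_graph_operator tO.
(* The range of [mp_graph t] is the part of the domain orthogonal to Ker t; its orthogonal is no
   larger than Ker t because the domain is dense. *)
have kerE x : t (x, 0) <-> perp (ran (mp_graph t)) x.
  split=> [x0 _ [[y z] [/= zP _] <-]/=|xP]; first exact: (perp_innerl zP).
  have [k [x' [xE k0 x'P]]] := kernel_decomp tO tC x.
  suff x'0 : x' = 0 by rewrite xE x'0 addr0.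
  apply: (dense_perp0 tD) => _ [[z v] zv <-] /=.
  have [k' [z' [zE k'0 z'P]]] := kernel_decomp tO tC z.
  have z'v : t (z', v) by have := opB tO zv k'0; rewrite subr0 zE addrC addKr.
  have sz' : ran (mp_graph t) z'.
    exists (v, z') => //; split => //; exists v; rewrite //= subrr.
    exact: perp0.
  have xk : x' = x - k by rewrite xE addrC addKr.
  change (inner z x' = 0); rewrite zE innerDl (perp_inner x'P k'0) add0r.
  by rewrite xk innerB (perp_inner xP sz') (perp_innerl z'P k0) subr0.
apply/seteqP; split=> [[x z] [v /= xv vz]|[x z] [/= [[v z'] vz /= E] xz]].
  have [/= zP [v' zv' vv']] := vz.
  split=> /=; first by exists (v, z).
  apply/kerE; have E : v = v'.
    have [z'' vz'' z''v] := mp_graph_ran tO tC xv.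
    have zz'' : z = z'' := op_fun sO vz vz''.
    by subst z''; exact: (op_fun tO z''v zv').
  by subst v'; rewrite -(subrr v); exact: opB.
subst z'; have [/= zP [u zu vu]] := vz.
have xu : t (x, u).
  have x0 : t (x - z, 0) by apply/kerE.
  by have := opD tO x0 zu; rewrite subrK add0r.
exists u => //; split => //=; exists u; rewrite //= subrr; exact: perp0.
Qed.

Lemma mp_graph_mp_inverse X Y (t : set (X * Y)) : cdd t ->
  mp_inverse t (mp_graph t).
Proof.
move=> tP; have [tO tD tC] := tP; have sP := cdd_mp_graph tP.
have sO := cdd_op sP.
split; [exact: cdd_regular|exact: cdd_regular| | |].
- split; apply/seteqP; split.
  + move=> [x v] [v' /= xv' [x' v'x' x'v]].
    have [x'' v'x'' x''v'] := mp_graph_ran tO tC xv'.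
    have E : x' = x'' := op_fun sO v'x' v'x''; subst x''.
    by have E : v = v' := op_fun tO x'v x''v'; subst v'.
  + move=> [x v] xv; have [x' vx' x'v] := mp_graph_ran tO tC xv.
    by exists v => //; exists x'.
  + move=> [y x] [x' /= yx' [v x'v vx]].
    have [/= x'P _] := yx'; have [/= xP [v' xv' vv']] := vx.
    have [x'' vx'' x''v] := mp_graph_ran tO tC x'v.
    have E : x = x'' := op_fun sO vx vx''; subst x''.
    by have E : x = x' := perp_kernel_inj tO x''v x'v xP x'P; subst x'.
  + move=> [y x] yx; have [/= xP [v xv yv]] := yx.
    exists x => //; exists v => //.
    by split => //=; exists v; rewrite //= subrr; exact: perp0.
- by rewrite comp_mp_graph//; apply: partial_proj_adj; exact: ran_submod.
- by rewrite mp_graph_comp//; apply: partial_proj_adj; exact: ran_submod.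
Qed.

(** The two adjoint conditions make ts and st symmetric. Symmetry of st puts the values of s in the
    orthogonal of Ker t, and symmetry of ts makes y - t s y orthogonal to Ran t. For the reverse
    inclusion, s must vanish on the orthogonal of Ran t. *)
Lemma mp_inverse_unique X Y (t : set (X * Y)) (s : set (Y * X)) :
  mp_inverse t s -> s = mp_graph t.
Proof.
move=> [[tO _ _ _ _] [sO _ sC _ _] [tst sts] tsA stA].
have ts_sym y v y' v' : opcomp t s (y, v) -> opcomp t s (y', v') ->
    inner v' y = inner y' v.
  move=> yv y'v'; have : adj (opcomp t s) (y, v) by rewrite tsA; exact: subset_closure.
  by move=> /(_ _ _ y'v').
have st_sym x z x' z' : opcomp s t (x, z) -> opcomp s t (x', z') ->
    inner z' x = inner x' z.
  move=> xz x'z'; have : adj (opcomp s t) (x, z) by rewrite stA; exact: subset_closure.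
  by move=> /(_ _ _ x'z').
have tE x v : t (x, v) -> exists2 x', s (v, x') & t (x', v).
  move=> xv; have := xv; rewrite -{1}tst => -[v' /= xv' [x' v'x' x'v]].
  have E : v = v' := op_fun tO xv xv'; subst v'.
  by exists x'.
have sE y x : s (y, x) -> exists2 v, t (x, v) & s (v, x).
  move=> yx; have := yx; rewrite -{1}sts => -[x' /= yx' [v x'v vx]].
  have E : x = x' := op_fun sO yx yx'; subst x'.
  by exists v.
have s_sub : s `<=` mp_graph t.
  move=> [y x] yx; have [v xv vx] := sE _ _ yx.
  have yv0 : s (y - v, 0) by rewrite -(subrr x); exact: opB.
  split=> /=.
    move=> k k0.
    have := @st_sym x x k 0 (ex_intro2 _ _ v xv vx) (ex_intro2 _ _ 0 k0 (op0 sO)).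
    by rewrite inner0l => /esym.
  exists v => // _ [[x' v'] x'v' <-] /=.
  have [x'' v'x'' x''v'] := tE _ _ x'v'.
  have := @ts_sym v' v' (y - v) 0 (ex_intro2 _ _ x'' v'x'' x''v')
    (ex_intro2 _ _ 0 yv0 (op0 tO)).
  rewrite inner0l => /esym E.
  exact: (@hip_sym0 _ _ _ (hilbert_hmod Y)).
apply/seteqP; split => // -[y x] [/= xP [v xv yv]].
have vx : s (v, x).
  have [x' vx' x'v] := tE _ _ xv.
  have [/= x'P _] := s_sub _ vx'.
  by rewrite (perp_kernel_inj tO xv x'v xP x'P).
suff n0 : s (y - v, 0) by have := opD sO n0 vx; rewrite subrK add0r.
(* Here the full equality of the adjoint with the closure is used: it yields points (a, b) of the
   graph of ts close to (y - v, 0). *)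
have : adj (opcomp t s) (y - v, 0).
  move=> y' v' [x' /= y'x' x'v']; rewrite inner0; apply: yv.
  by exists (x', v').
rewrite tsA => /closure_nm2/= cl.
apply: sC; apply/closure_nm2 => e e0.
have e20 : 0 < e / 2 by rewrite divr_gt0.
have [[a b] [x' /= ax' x'b] [ya b0]] := cl _ e20.
have [b' x'b' b'x'] := sE _ _ ax'.
have E : b = b' := op_fun tO x'b x'b'; subst b'.
(* Both a and b = t s a have the image s a, so s kills a - b, which is still close to y - v. *)
exists (a - b, 0) => /=; first by rewrite -(subrr x'); exact: opB.
split; last by rewrite subr0 /nm normr0.
have -> : y - v - (a - b) = (y - v - a) + b by rewrite opprB addrA addrAC.
rewrite (le_lt_trans (nmD _ _))// [e]splitr ltrD//.
by move: b0; rewrite sub0r nmN.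
Qed.

Theorem mpinvE X Y (t : set (X * Y)) : cdd t -> mpinv t = mp_graph t.
Proof.
move=> tP; apply: mp_inverse_unique; rewrite /mpinv.
by apply: xgetPex; exists (mp_graph t); exact: mp_graph_mp_inverse.
Qed.

End MoorePenroseInverse.

(** * Uniform boundedness *)

Section UniformBoundedness.
Context (R : realType) (V : completeNormedModType R[i]).
Implicit Types (x y z w : V) (f : V -> R).

Definition bounded_functional f : Prop :=
  [/\ forall x y, f (x + y) = f x + f y,
      forall (c : R) x, f (c%:C *: x) = c * f x &
      exists2 C : R, 0 <= C & forall x, `|f x| <= C * nm x].

Lemma inv_succ_lt (e : R) : 0 < e ->
  exists N, forall n, (N <= n)%N -> n.+1%:R^-1 < e.
Proof.
move=> e0; exists (Num.truncn e^-1) => n Nn.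
rewrite -[ltRHS]invrK ltf_pV2 ?posrE ?invr_gt0//.
by apply: lt_le_trans (truncnS_gt _) _; rewrite ler_nat.
Qed.

Lemma uniform_boundedness (F : set (V -> R)) :
  (forall f, F f -> bounded_functional f) ->
  (forall x, exists M : R, forall f, F f -> `|f x| <= M) ->
  exists2 K : R, 0 <= K & forall f, F f -> forall x, `|f x| <= K * nm x.
Proof.
move=> Fb Fpt.
(* Either the whole family is bounded by n on some ball of radius r, and differences of two of its
   points give the constant 2 n / r; or every ball contains points where members of the family are
   arbitrarily large, and nested balls lead to a point contradicting [Fpt]. *)
have [[n [x0 [r [r0 bnd]]]]|nbnd] := pselect (exists (n : nat) x0 (r : R),
    0 < r /\ forall f z, F f -> nm (z - x0) <= r -> `|f z| <= n%:R).
  exists (2 * n%:R / r) => [|f Ff y]; first by rewrite divr_ge0 ?mulr_ge0 ?(ltW r0).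
  have [fD fZ [C C0 fC]] := Fb _ Ff.
  have [->|yN0] := eqVneq y 0.
    by rewrite (le_trans (fC 0))// /nm normr0/= !mulr0.
  have y0 : 0 < nm y by rewrite nm_gt0.
  have c0 : 0 < r / nm y by rewrite divr_gt0.
  have h1 : `|f ((r / nm y)%:C *: y + x0)| <= n%:R.
    by apply: bnd => //; rewrite addrK nmZ gtr0_norm// divfK ?gt_eqF.
  have h2 : `|f x0| <= n%:R by apply: bnd; rewrite // subrr /nm normr0/= ltW.
  have : `|r / nm y * f y| <= 2 * n%:R.
    have -> : r / nm y * f y = f ((r / nm y)%:C *: y + x0) - f x0.
      by rewrite fD fZ addrK.
    by rewrite (le_trans (ler_normB _ _))// mulr2n mulrDl mul1r lerD.
  rewrite normrM gtr0_norm// => h.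
  have -> : 2 * n%:R / r * nm y = (r / nm y)^-1 * (2 * n%:R).
    by field; rewrite !gt_eqF.
  by rewrite ler_pdivlMl.
have step (a : nat * (V * R)) : exists b : V * R, 0 < a.2.2 ->
    [/\ 0 < b.2, b.2 <= a.2.2 / 2,
        forall z, nm (z - b.1) <= b.2 -> nm (z - a.2.1) <= a.2.2 &
        exists2 f, F f & forall z, nm (z - b.1) <= b.2 -> a.1%:R < `|f z|].
  case: a => n [x0 r] /=.
  have [r0|] := ltrP 0 r; last by exists (0, 0).
  have [f [z [Ff zx0 fz]]] : exists f z,
      [/\ F f, nm (z - x0) <= r / 2 & n%:R < `|f z|].
    apply: contrapT => h; apply: nbnd; exists n, x0, (r / 2).
    split=> [|f z Ff zx0]; first by rewrite divr_gt0.
    by rewrite leNgt; apply/negP => fz; apply: h; exists f, z.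
  have [fD fZ [C C0 fC]] := Fb _ Ff.
  have C1 : 0 < 2 * (C + 1) by rewrite mulr_gt0// ltr_wpDl.
  (* On the ball of radius [d] around [z], [f] varies by less than |f z| - n, so it still exceeds
     n. *)
  pose d := (`|f z| - n%:R) / (2 * (C + 1)).
  have d0 : 0 < d by rewrite divr_gt0// subr_gt0.
  exists (z, Num.min (r / 2) d) => _ /=; split.
  - by rewrite lt_min divr_gt0.
  - by rewrite ge_min lexx.
  - move=> w; rewrite le_min => /andP[wz _].
    have -> : w - x0 = (w - z) + (z - x0) by rewrite addrA subrK.
    by rewrite (le_trans (nmD _ _))// [leRHS]splitr lerD.
  - exists f => // w; rewrite le_min => /andP[_ wz].
    have fzw : `|f z| <= `|f w| + `|f (w - z)|.
      have -> : f z = f w - f (w - z).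
        by have := fD (w - z) z; rewrite subrK => ->; rewrite addrAC subrr add0r.
      exact: ler_normB.
    have fwz : `|f (w - z)| <= C * d.
      by rewrite (le_trans (fC _))// ler_wpM2l.
    have dE : 2 * (C * d + d) = `|f z| - n%:R.
      by rewrite /d; field; rewrite gt_eqF// ltr_wpDl.
    have Cd : 0 <= C * d by rewrite mulr_ge0// ltW.
    lra.
have [g gP] := choice step.
pose fix st n : V * R := if n is n'.+1 then g (n', st n') else (0, 1).
have st0 n : 0 < (st n).2.
  by elim: n => [|n ih]; [exact: ltr01|have [] := gP (n, st n) ih].
have stP n := gP (n, st n) (st0 n).
have st_small n : (st n).2 <= n.+1%:R^-1.
  elim: n => [|n ih]; first by rewrite invr1.
  have [_ le _ _] := stP n; rewrite (le_trans le)//=.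
  rewrite ler_pdivrMr// (le_trans ih)//.
  rewrite [leRHS]mulrC ler_pdivlMr// mulrC ler_pdivrMr// -natrM ler_nat.
  by rewrite mul2n -addnn addnS ltnS leq_addr.
have nest n k : (n <= k)%N ->
    forall z, nm (z - (st k).1) <= (st k).2 -> nm (z - (st n).1) <= (st n).2.
  elim: k => [|k ih]; first by rewrite leqn0 => /eqP ->.
  rewrite leq_eqVlt => /orP[/eqP ->//|nk] z zk.
  by apply: ih => //; have [_ _ h _] := stP k; exact: h.
have cent n k : (n <= k)%N -> nm ((st k).1 - (st n).1) <= (st n).2.
  by move=> nk; apply: (nest _ _ nk); rewrite subrr /nm normr0/= ltW.
have [|l lP] := nm_complete (u := fun n => (st n).1).
  move=> e e0; have [N NP] := inv_succ_lt (divr_gt0 e0 (ltr0Sn R 1)).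
  exists N => n k Nn Nk.
  have -> : (st n).1 - (st k).1 = ((st n).1 - (st N).1) - ((st k).1 - (st N).1).
    by rewrite opprB addrA subrK.
  rewrite (le_lt_trans (nmD _ _))// nmN [ltRHS]splitr ltrD//.
    by rewrite (le_lt_trans (cent _ _ Nn))// (le_lt_trans (st_small N))// NP.
  by rewrite (le_lt_trans (cent _ _ Nk))// (le_lt_trans (st_small N))// NP.
have lball n : nm (l - (st n).1) <= (st n).2.
  rewrite leNgt; apply/negP => h; rewrite -subr_gt0 in h.
  have [N NP] := lP _ h.
  have := NP (maxn n N) (leq_maxr _ _).
  have := cent _ _ (leq_maxl n N).
  have : nm (l - (st n).1) <=
      nm ((st (maxn n N)).1 - l) + nm ((st (maxn n N)).1 - (st n).1).
    rewrite -(nmN (_ - l)) opprB; apply: le_trans (nmD _ _).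
    by rewrite addrA subrK.
  lra.
have [M MP] := Fpt l.
(* The ball [st n.+1] comes with a functional exceeding n on it, and truncn M + 1 exceeds M. *)
have [_ _ _ [f Ff fn]] := stP (Num.truncn M).+1.
exfalso; have := fn l (lball (Num.truncn M).+2); rewrite ltNge => /negP; apply.
by rewrite (le_trans (MP f Ff))//= ltW// truncnS_gt.
Qed.

End UniformBoundedness.

Section EverywhereDefined.
Context (R : realType) (I : Type) (H : I -> hilbertSpace R).
Implicit Types X Y : hilbertModule H.
Local Notation hM := (@hilbert_hmod R I H).

(** Uniform boundedness is applied to the functionals [phi u z] with |w|, |u| <= 1. They are
    pointwise bounded because <z, x> = <w, s x>; evaluating them at x = z gives |z|^2 <= K |z|. *)
Lemma adj_bounded X Y (s : set (X * Y)) : (forall x, dom s x) ->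
  exists2 K : R, 0 <= K & forall w z, adj s (w, z) -> nm z <= K * nm w.
Proof.
move=> sT.
pose F : set (X -> R) := [set f | exists w z i (u : H i),
  [/\ adj s (w, z), nm w <= 1, nm u <= 1 & f = @phi _ _ _ (hM X) i u z]].
have [f [w [z [i [u [_ _ _ ->]]]]]|x|K K0 KP] := @uniform_boundedness R X F.
- have E := psd_phi (hM X) u; split.
  + exact: psdD E z.
  + by move=> c x; exact: psdZ E c z x.
  + have [L /(_ i u)[L0 LP]] := @phi_hnm _ _ _ (hM X) z.
    exists (L i u + 1) => [|x]; first by rewrite addr_ge0.
    have L1 : 0 <= (L i u + 1) * nm x by rewrite mulr_ge0 ?nm_ge0// addr_ge0.
    rewrite -ler_sqr ?nnegrE// real_normK ?num_real//.
    rewrite (le_trans (LP x))// exprMn ler_wpM2r ?sqr_ge0//.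
    have -> : (L i u + 1) ^+ 2 = L i u + (L i u ^+ 2 + L i u + 1) by ring.
    by rewrite lerDl !addr_ge0 ?sqr_ge0.
- have [[x' y] xy /= E] := sT x; subst x'.
  have [C C0 CP] := hip_ub (hM Y).
  exists (C * nm y) => f [w [z [i [u [wz w1 u1 ->]]]]].
  have -> : @phi _ _ _ (hM X) i u z x = @phi _ _ _ (hM Y) i u w y.
    have /= /inner_sym E := wz _ _ xy.
    by change (qf (inner z x) u = qf (inner w y) u); rewrite E.
  have h0 : 0 <= C * nm y by rewrite mulr_ge0 ?nm_ge0// ltW.
  rewrite -ler_sqr ?nnegrE// real_normK ?num_real//.
  rewrite (le_trans (psd_CS (psd_phi (hM Y) u) w y))//.
  have -> : (C * nm y) ^+ 2 = C * (C * nm y ^+ 2) by ring.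
  apply: ler_pM; rewrite ?(psd_ge0 (psd_phi (hM Y) u))//; last exact: CP.
  apply: (le_trans (CP w i u u1)); rewrite ler_piMr ?(ltW C0)//.
  by rewrite -[leRHS](expr1n _ 2) ler_sqr ?nnegrE ?nm_ge0.
have small w z : adj s (w, z) -> nm w <= 1 -> nm z <= K.
  move=> wz w1; have [->|zN0] := eqVneq z 0; first by rewrite /nm normr0.
  have z0 : 0 < nm z by rewrite nm_gt0.
  rewrite -(ler_pM2r z0) -expr2.
  apply: (@hip_lb _ _ _ (hM X) z) => [|i u u1]; first by rewrite mulr_ge0// ltW.
  apply: le_trans (ler_norm _) _.
  by apply: (KP (@phi _ _ _ (hM X) i u z)); exists w, z, i, u.
exists K => // w z wz; have [w0|wN0] := eqVneq w 0.
  suff -> : z = 0 by rewrite /nm normr0 mulr_ge0// nm_ge0.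
  have [[x' y] xy /= E] := sT z; subst x'.
  by apply: inner_eq0; rewrite -(wz _ _ xy)/= w0 inner0.
have w0 : 0 < nm w by rewrite nm_gt0.
have wz' : adj s ((nm w)^-1%:C *: w, (nm w)^-1%:C *: z).
  by move=> x tx xtx /=; rewrite !innerZ (wz _ _ xtx).
have := small _ _ wz'; rewrite !nmZ gtr0_norm ?invr_gt0// mulVf ?gt_eqF//.
by move=> /(_ (lexx _)); rewrite ler_pdivrMl// mulrC.
Qed.

(** By [adj_bounded] the adjoint maps a sequence of its dense domain converging to [w] to a Cauchy
    sequence; its graph being closed, the limit is a value at [w]. *)
Lemma adj_everywhere X Y (s : set (X * Y)) : cdd s -> (forall x, dom s x) ->
  forall w, exists z, adj s (w, z).
Proof.
move=> sP sT w; have [K K0 KP] := adj_bounded sT.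
have [aO /denseP aD aC] := cdd_adj sP.
have wex n : exists p : Y * X, adj s p /\ nm (w - p.1) < n.+1%:R^-1.
  have [|w' [[a b] ab <-] ww'] := aD w (n.+1%:R^-1); first by rewrite invr_gt0.
  by exists (a, b).
have [p pP] := choice wex.
have pB n k : nm ((p n).2 - (p k).2) <= K * (n.+1%:R^-1 + k.+1%:R^-1).
  have [an wn] := pP n; have [ak wk] := pP k.
  have ap m : adj s ((p m).1, (p m).2) by rewrite -surjective_pairing; exact: (pP m).1.
  have h := KP _ _ (opB aO (ap n) (ap k)); rewrite (le_trans h)// ler_wpM2l//.
  have -> : (p n).1 - (p k).1 = (w - (p k).1) - (w - (p n).1).
    by rewrite opprB [RHS]addrC addrA subrK.
  rewrite (le_trans (nmD _ _))// nmN addrC.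
  by rewrite lerD// ltW.
have [|z zP] := nm_complete (u := fun n => (p n).2).
  move=> e e0.
  have K1 : 0 < 2 * (K + 1) by rewrite mulr_gt0// ltr_wpDl.
  have [N NP] := inv_succ_lt (divr_gt0 e0 K1).
  exists N => n k /NP hn /NP hk; apply: (le_lt_trans (pB n k)).
  have : n.+1%:R^-1 + k.+1%:R^-1 < e / (K + 1).
    have -> : e / (K + 1) = e / (2 * (K + 1)) + e / (2 * (K + 1)).
      by field; rewrite gt_eqF// ltr_wpDl.
    exact: ltrD.
  rewrite ltr_pdivlMr ?ltr_wpDl// => h.
  apply: le_lt_trans h; rewrite mulrC; apply: ler_wpM2l; last by rewrite lerDl.
  by rewrite addr_ge0// invr_ge0.
exists z; apply: aC; apply/closure_nm2 => e e0.
have [N NP] := zP _ e0; have [N' NP'] := inv_succ_lt e0.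
pose n := maxn N N'.
exists (p n) => /=; first exact: (pP n).1.
split.
  by apply: lt_trans (pP n).2 _; apply: NP'; rewrite leq_maxr.
by rewrite -nmN opprB; apply: NP; rewrite leq_maxl.
Qed.

End EverywhereDefined.

(** * Formulas and commutation rules for t^dagger *)

Section Corollary.
Context (R : realType) (I : Type) (H : I -> hilbertSpace R).
Implicit Types X Y : hilbertModule H.

(** Presents t t^* as s^* s with s = t^*, so that the results on t^* t transfer. *)
Lemma comp_adj_adj X Y (t : set (X * Y)) : cdd t ->
  t ** adj t = adj (adj t) ** adj t.
Proof. by move=> [tO _ tC]; rewrite adj_adj. Qed.

(** By self-adjointness, both the kernel of t^* t and the orthogonal of its range are Ker t. *)
Lemma mp_graph_adj_comp X Y (t : set (X * Y)) : cdd t -> forall z x,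
  mp_graph (adj t ** t) (z, x) <->
  perp (kernel t) x /\ exists2 v, (adj t ** t) (x, v) & t (z - v, 0).
Proof.
move=> tP z x; have aO := cdd_op (cdd_adj tP).
have kE : kernel (adj t ** t) = kernel t.
  apply/seteqP; split=> y; first exact: adj_comp_kernel (cdd_op tP).
  exact: opcomp_kernel.
have pE n : perp (ran (adj t ** t)) n <-> t (n, 0).
  rewrite -adj_kernelP (adj_comp_adj tP).
  by split; [exact: adj_comp_kernel (cdd_op tP)|exact: opcomp_kernel].
by split=> -[xP [v xv zv]]; split; rewrite ?kE// -?kE//; exists v => //; apply/pE.
Qed.

Lemma mp_graph_comp_adj X Y (t : set (X * Y)) : cdd t -> forall y w,
  mp_graph (t ** adj t) (y, w) <->
  perp (kernel (adj t)) w /\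
  exists2 v, (t ** adj t) (w, v) & adj t (y - v, 0).
Proof.
move=> tP y w; rewrite (comp_adj_adj tP); exact: mp_graph_adj_comp (cdd_adj tP) y w.
Qed.

Lemma ran_adj_perp X Y (t : set (X * Y)) x : ran (adj t) x ->
  perp (kernel t) x.
Proof.
by move=> [[w z] wz <-] k k0 /=; have := wz _ _ k0; rewrite /= inner0l => /esym.
Qed.

(** If w is the value at y and v = t t^* w, then t^* w is a preimage of v orthogonal to Ker t, while
    y - v lies in Ker t^*. *)
Lemma adj_comp_mp_sub X Y (t : set (X * Y)) : cdd t ->
  adj t ** mp_graph (t ** adj t) `<=` mp_graph t.
Proof.
move=> tP; have [tO tD tC] := tP; have aO := cdd_op (cdd_adj tP).
move=> [y x] [w /= yw wx].
have [_ [v [x' /= wx' x'v] yv]] := (mp_graph_comp_adj tP y w).1 yw.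
have E : x = x' := op_fun aO wx wx'; subst x'.
split; first by apply: ran_adj_perp; exists (w, x).
by exists v => //; exact/adj_kernelP.
Qed.

(** The domain of t^dagger contains Ran t, so the inclusion forces t^* to be defined there.
    Conversely, t^* ignores the Ker t^* component of y, and x is recovered from t^* t x. *)
Lemma mp_sub_comp_adj X Y (t : set (X * Y)) : cdd t ->
  mp_graph t `<=` mp_graph (adj t ** t) ** adj t <-> ran t `<=` dom (adj t).
Proof.
move=> tP; have [tO tD tC] := tP; have aO := cdd_op (cdd_adj tP).
split=> [sub _ [[x v] xv <-] /=|sub [y x] [/= xP [v xv yv]]].
  have [x' vx' _] := mp_graph_ran tO tC xv.
  by have [z vz _] := sub _ vx'; exists (v, z).
have [|[v' z] vz /= E] := sub v; first by exists (x, v).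
subst v'; have yz : adj t (y, z).
  have yv0 : adj t (y - v, 0) by exact/adj_kernelP.
  by have := opD aO yv0 vz; rewrite subrK add0r.
exists z => //; apply/(mp_graph_adj_comp tP); split=> //.
by exists z; [exists v|rewrite subrr; exact: op0].
Qed.

(** The difference of t^* y and t^* t x lies in Ran t^* and in Ker t, so it is 0. This is the
    inclusion that turns (b) into the second equality of (c). *)
Lemma comp_adj_mp_sub X Y (t : set (X * Y)) : cdd t ->
  mp_graph (adj t ** t) ** adj t `<=` mp_graph t.
Proof.
move=> tP; have [tO tD tC] := tP; have aO := cdd_op (cdd_adj tP).
move=> [y x] [z /= yz /(mp_graph_adj_comp tP)[xP [z' [v /= xv vz'] zz']]].
split=> //; exists v => //; apply/adj_kernelP.
have yv : adj t (y - v, z - z') by exact: (opB aO yz vz').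
suff E : z - z' = 0 by rewrite -E.
apply: (@perp_self0 _ _ _ _ (kernel t)) => //.
by apply: ran_adj_perp; exists (y - v, z - z').
Qed.

Lemma closed_ran_mp X Y (t : set (X * Y)) : cdd t -> closed (ran t) ->
  adj t ** mp_graph (t ** adj t) = mp_graph t.
Proof.
move=> tP rC; have [tO tD tC] := tP; have aP := cdd_adj tP.
have aO := cdd_op aP.
apply/seteqP; split; first exact: adj_comp_mp_sub.
have sT y : dom (mp_graph t) y.
  have [v [n [yE vP nP]]] := biperp_decomp (ran_submod tO) y.
  have [[x v'] xv /= E] := closed_biperp (ran_submod tO) rC vP; subst v'.
  have [x' vx' _] := mp_graph_ran tO tC xv.
  exists (y, x') => //; rewrite yE -[x']addr0.
  by apply: (opD (mp_graph_operator tO)) => //; exact: mp_graph_kernel.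
move=> [y x] [/= xP [v xv yv]].
have [w' xw'] := adj_everywhere (cdd_mp_graph tP) sT x.
(* The adjoint of t^dagger is a right inverse of t^* on the orthogonal of Ker t: for a = k + a', <a,
   x> = <a', x> = <t a, w'>, since t^dagger sends t a to a'. *)
have w'x : adj t (w', x).
  move=> a ta ata /=.
  have [k [a' [aE k0 a'P]]] := kernel_decomp tO tC a.
  have a'ta : t (a', ta) by have := opB tO ata k0; rewrite subr0 aE addrC addKr.
  rewrite aE innerDl (perp_inner xP k0) add0r.
  apply/esym/(xw' ta a'); split => //; exists ta => //=.
  by rewrite subrr; exact: perp0.
(* Values of the Moore-Penrose inverse of t t^* are orthogonal to Ker t^*, so that component of [w']
   is removed. *)
have [k [w [wE k0 wP]]] := kernel_decomp aO (cdd_closed aP) w'.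
have wx : adj t (w, x).
  by have := opB aO w'x k0; rewrite subr0 wE addrC addKr.
exists w => //; apply/(mp_graph_comp_adj tP); split=> //.
by exists v; [exists x|exact/adj_kernelP].
Qed.

Lemma mp_graph_commute X (t : set (X * X)) (S : X -> X) : cdd t ->
  bounded_adjointable S ->
  graph S ** t `<=` t ** graph S ->
  graph S ** adj t `<=` adj t ** graph S ->
  graph S ** mp_graph t `<=` mp_graph t ** graph S.
Proof.
move=> tP [Sl _ _ [S' SS']] St Sa; have [tO tD tC] := tP.
pose F : {linear X -> X} := HB.pack S (GRing.isLinear.Build _ _ _ _ S Sl).
have SB a b : S (a - b) = S a - S b by exact: (linearB F).
have S0 : S 0 = 0 by exact: (linear0 F).
have StE a b : t (a, b) -> t (S a, S b).
  move=> ab; have [|c E h] := St (a, S b); first by exists b.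
  by move: E h; rewrite /graph/= => ->.
have SaE a b : adj t (a, b) -> adj t (S a, S b).
  move=> ab; have [|c E h] := Sa (a, S b); first by exists b.
  by move: E h; rewrite /graph/= => ->.
(* Through t = t^**, commutation of S with t^* makes [S'] preserve Ker t, whence S preserves its
   orthogonal. *)
have S'k k : kernel t k -> kernel t (S' k).
  move=> k0; rewrite /kernel/= -{1}(adj_adj tO tC) => y z /SaE yz /=.
  have E : inner k (S z) = 0 by rewrite -(yz _ _ k0) inner0l.
  rewrite inner0 -[LHS]SS'.
  exact: (@hip_sym0 _ _ _ (hilbert_hmod X)).
move=> [y z] [x [/= xP [v xv yv]] E]; move: E; rewrite /graph/= => ->.
exists (S y) => //; split=> /=.
  move=> k k0; apply: (@hip_sym0 _ _ _ (hilbert_hmod X)).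
  rewrite [LHS]SS'; exact: (perp_innerl xP (S'k _ k0)).
exists (S v); first exact: StE.
rewrite -SB; apply/adj_kernelP; rewrite -S0; apply: SaE; exact/adj_kernelP.
Qed.

Lemma closure_mp_comp_adj X Y (t : set (X * Y)) : cdd t ->
  closure (mp_graph t ** t) ** adj t = adj t.
Proof.
move=> tP; have [tO tD tC] := tP.
(* The closure is traded for the adjoint, membership in which is checked by pairing. *)
have [_ _ _ _ <-] := mp_graph_mp_inverse tP.
have stD : densely_defined (mp_graph t ** t).
  apply/denseP => x e e0; have /denseP := tD.
  move=> /(_ x e e0)[_ [[a b] ab <-] xa]; exists a => //=.
  have [a' ba' _] := mp_graph_ran tO tC ab.
  by exists (a, a') => //; exists b.
have id z : ran (adj t) z -> adj (mp_graph t ** t) (z, z).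
  move=> /ran_adj_perp zP x' x1 [b /= x'b bx1].
  have [x2 bx2 x2b] := mp_graph_ran tO tC x'b.
  have E : x1 = x2 := op_fun (mp_graph_operator tO) bx1 bx2; subst x2.
  have k0 : t (x' - x1, 0) by have := opB tO x'b x2b; rewrite subrr.
  by rewrite -[in RHS](subrK x1 x') innerDl (perp_inner zP k0) add0r.
apply/seteqP; split=> [[y z'] [z /= yz zz']|[y z] yz].
  have zr : ran (adj t) z by exists (y, z).
  by have E : z' = z := op_fun (adj_operator stD) zz' (id _ zr); rewrite E.
by exists z => //; apply: id; exists (y, z).
Qed.

End Corollary.

Theorem corollary2p8 (R : realType) (I : Type) (H : I -> hilbertSpace R) :
  (forall (X Y : hilbertModule H) (t : set (X * Y)),
    operator t -> densely_defined t -> closed t ->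
    [/\ adj t ** mpinv (t ** adj t) `<=` mpinv t,
        mpinv t `<=` mpinv (adj t ** t) ** adj t <-> ran t `<=` dom (adj t) &
        closed (ran t) ->
          adj t ** mpinv (t ** adj t) = mpinv t /\
          (ran t `<=` dom (adj t) -> mpinv t = mpinv (adj t ** t) ** adj t)]) /\
  (forall (X : hilbertModule H) (t : set (X * X)),
    operator t -> densely_defined t -> closed t ->
    (forall S : X -> X, bounded_adjointable S ->
      graph S ** t `<=` t ** graph S ->
      graph S ** adj t `<=` adj t ** graph S ->
      graph S ** mpinv t `<=` mpinv t ** graph S) /\
    (t = adj t <-> t = closure (mpinv t ** t) ** adj t)).
Proof.
split=> [X Y t tO tD tC|X t tO tD tC]; have tP : cdd t by split.
  have ttP : cdd (t ** adj t).
    by rewrite (comp_adj_adj tP); exact: cdd_adj_comp (cdd_adj tP).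
  rewrite !mpinvE//; last exact: cdd_adj_comp.
  split; [exact: adj_comp_mp_sub|exact: mp_sub_comp_adj|move=> rC; split].
    exact: closed_ran_mp.
  move=> rt; apply/seteqP; split; last exact: comp_adj_mp_sub.
  exact/mp_sub_comp_adj.
rewrite !mpinvE//; split=> [S|]; first exact: mp_graph_commute.
by rewrite closure_mp_comp_adj.
Qed.
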